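(* Let $N\ge 1$, let $q$ be a generic parameter and $s=(s_1,\dots,s_N)$ indeterminates. Let $f^{B_N{\rm Toda}}(x|s|q)$ be the $B_N$ $q$-Toda function and $f^{A_{N-1}{\rm Toda}}(x|s|q)$ the $A_{N-1}$ $q$-Toda function defined in the context. Then \[ f^{B_N{\rm Toda}}(x_1,\ldots,x_N|s_1,\ldots,s_N|q)=\sum_{\theta=(\theta_1,\ldots,\theta_N)\in \mathbb{Z}^N_{\geq 0}}e^{B_N/A_{N-1}}_{\theta}(s|q) \cdot \prod_{i=1}^N x_i^{-\theta_i} \cdot f^{A_{N-1}{\rm Toda}}(x_1,\ldots ,x_N|q^{-\theta_1}s_1,\ldots ,q^{-\theta_N}s_N|q), \] where \[ e^{B_N/A_{N-1}}_{\theta}(s|q):=\prod_{k=1}^N\frac{q^{(N-k+1)\theta_k}}{(q;q)_{\theta_k}(q/s_k^2;q)_{\theta_k}}\prod_{1\leq i<j\leq N}\frac{1}{(q s_j/s_i;q)_{\theta_i}\,(q^{\theta_j-\theta_i} q s_i/s_j;q)_{\theta_i}}\cdot\frac{(q/s_is_j;q)_{\theta_i+\theta_j}}{(q/s_is_j;q)_{\theta_i}\,(q/s_is_j;q)_{\theta_j}}. \]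
   Context: Notation: $(a;q)_n:=\prod_{k=1}^n(1-q^{k-1}a)$. For $x=(x_1,\dots,x_N)$, $T_{q,x_i}$ is the operator $T_{q,x_i}f(x_1,\ldots,x_N)=f(x_1,\ldots,qx_i,\ldots,x_N)$. $A_{N-1}$ $q$-Toda function: let $\mathsf{M}^{(N)}$ be the set of $N\times N$ strictly upper triangular matrices $\boldsymbol\theta=(\theta_{i,j})$ with entries in $\mathbb{Z}_{\ge0}$ ($\theta_{k,l}=0$ if $k\ge l$). Define \[ c^{\rm Toda}_N(\boldsymbol{\theta};s;q)=\prod_{k=2}^{N}\prod_{1\leq i\leq j\leq k-1}\frac{1}{(q^{\sum_{a=k+1}^N(\theta_{i,a}-\theta_{j+1,a})}qs_{j+1}/s_i;q)_{\theta_{i,k}}}\cdot\frac{q^{\theta_{i,k}}}{(q^{\theta_{j,k}-\theta_{i,k}-\sum_{a=k+1}^N(\theta_{i,a}-\theta_{j,a})}q s_i/s_j;q)_{\theta_{i,k}}} \] and \[ f^{A_{N-1}{\rm Toda}}(x|s|q)=\sum_{\boldsymbol{\theta}\in\mathsf{M}^{(N)}}c^{\rm Toda}_N(\boldsymbol{\theta};s;q)\prod_{1\leq i<j \leq N} (x_j/x_i)^{\theta_{i,j}}\in\mathbb{Q}(s,q)[[x_2/x_1,\ldots,x_N/x_{N-1}]]. \] In the formula, $f^{A_{N-1}{\rm Toda}}(x|q^{-\theta_1}s_1,\dots,q^{-\theta_N}s_N|q)$ means this series with $s_i$ replaced by $q^{-\theta_i}s_i$. $B_N$ $q$-Toda function: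 on $\Lambda^{B_N}:=\mathbb{Q}(s,q)[[x_2/x_1,\ldots,x_N/x_{N-1},1/x_N]]$ define \[ \mathsf{D}^{B_N{\rm Toda}}(x|s|q)=\sum_{i=1}^{N-1}s_i (1-x_{i+1}/x_i)T_{q,x_i}+s_N (1-1/x_N)T_{q,x_N}+s_1^{-1}T_{q,x_1}^{-1}+\sum_{i=2}^N s_i^{-1} (1-x_i/x_{i-1})T_{q,x_i}^{-1}. \] $f^{B_N{\rm Toda}}(x|s|q)$ is the unique element of $\Lambda^{B_N}$ satisfying $\mathsf{D}^{B_N{\rm Toda}}(x|s|q)f^{B_N{\rm Toda}}=\sum_{i=1}^N(s_i+s_i^{-1})f^{B_N{\rm Toda}}$ and whose constant term (coefficient of the monomial $1$ in the $x_i$) equals $1$. *)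

(* Defs.v *)
From HB Require Import structures.
From mathcomp Require Import all_boot all_order all_algebra.
From mathcomp Require Import fraction mpoly.
Set Implicit Arguments.
Unset Strict Implicit.
Unset Printing Implicit Defensive.
Import Order.TTheory GRing.Theory Num.Theory.
Local Open Scope ring_scope.

(* Conventions.  Throughout, N = n.+1 (so N >= 1).  All indices appearing in *)
(* the formulas are 1-based natural numbers, exactly as in the paper.        *)

Definition qpoch (F : fieldType) (q a : F) (k : nat) : F :=
  \prod_(l < k) (1 - q ^+ l * a).

(* Coefficient c^Toda_N(theta; s; q) of the A_{N-1} q-Toda function;
   theta is an N x N strictly upper triangular matrix, given as a function
   nat -> nat -> nat with 1-based indices. *)
Definition tailsum (N : nat) (th : nat -> nat -> nat) (i k : nat) : int :=
  (\sum_(k.+1 <= a < N.+1) th i a)%:Z.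

Definition cToda (F : fieldType) (N : nat) (th : nat -> nat -> nat)
    (s : nat -> F) (q : F) : F :=
  \prod_(2 <= k < N.+1) \prod_(1 <= i < k) \prod_(i <= j < k)
    ( (qpoch q (q ^ (tailsum N th i k - tailsum N th j.+1 k) * q * s j.+1 / s i)
             (th i k))^-1
      * (q ^+ th i k
         / qpoch q (q ^ ((th j k)%:Z - (th i k)%:Z
                          - (tailsum N th i k - tailsum N th j k)) * q * s i / s j)
                 (th i k)) ).

Definition eBA (F : fieldType) (N : nat) (th : nat -> nat)
    (s : nat -> F) (q : F) : F :=
  (\prod_(1 <= k < N.+1)
     (q ^+ ((N - k + 1) * th k)
      / (qpoch q q (th k) * qpoch q (q / (s k ^+ 2)) (th k))))
  * \prod_(1 <= i < N.+1) \prod_(i.+1 <= j < N.+1)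
      ( (qpoch q (q * s j / s i) (th i)
         * qpoch q (q ^ ((th j)%:Z - (th i)%:Z) * q * s i / s j) (th i))^-1
        * (qpoch q (q / (s i * s j)) (th i + th j)
           / (qpoch q (q / (s i * s j)) (th i) * qpoch q (q / (s i * s j)) (th j))) ).

Definition sums_to (F : fieldType) (I : eqType) (fam : I -> F) (v : F) : Prop :=
  exists r : seq I, [/\ uniq r, (forall i, i \notin r -> fam i = 0)
                      & v = \sum_(i <- r) fam i].

Section Toda.
Variable n : nat.
Local Notation N := n.+1.

(* The coefficient field Q(s,q): rational functions in the N+1
   indeterminates q = X_0, s_1 = X_1, ..., s_N = X_N. *)
Definition Kfield : fieldType := {fraction {mpoly rat[n.+2]}}.

Definition qK : Kfield := tofrac ('X_(inord 0) : {mpoly rat[n.+2]}).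
Definition sK (k : nat) : Kfield := tofrac ('X_(inord k) : {mpoly rat[n.+2]}).

(* Monomials of Lambda^{B_N} = Q(s,q)[[y_1,...,y_N]] where
   y_i = x_{i+1}/x_i (1 <= i <= N-1) and y_N = 1/x_N.
   A monomial y^m is given by m : {ffun 'I_N -> nat}; m_k (1-based) is
   yexp m k.  An element of Lambda^{B_N} is its coefficient function. *)
Definition mono := {ffun 'I_N -> nat}.
Definition series := mono -> Kfield.

Definition yexp (m : mono) (k : nat) : nat := m (inord k.-1).

(* exponent of x_k in the monomial y^m:  a_k = m_{k-1} - m_k  (m_0 := 0) *)
Definition xexp (m : mono) (k : nat) : int :=
  (if k is 1 then 0 else (yexp m k.-1)%:Z) - (yexp m k)%:Z.

Definition ydec (m : mono) (k : nat) : mono :=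
  [ffun j => if j == inord k.-1 then (m j).-1 else m j].

Definition ymul (k : nat) (G : series) : series :=
  fun m => if (0 < yexp m k)%N then G (ydec m k) else 0.

Definition Tq (i : nat) (e : int) (G : series) : series :=
  fun m => qK ^ (e * xexp m i) * G m.

(* D^{B_N Toda}(x|s|q), using x_{i+1}/x_i = y_i, 1/x_N = y_N,
   x_i/x_{i-1} = y_{i-1}. *)
Definition DBToda (G : series) : series :=
  fun m =>
    \sum_(1 <= i < N) sK i * (Tq i 1 G m - ymul i (Tq i 1 G) m)
    + sK N * (Tq N 1 G m - ymul N (Tq N 1 G) m)
    + (sK 1)^-1 * Tq 1 (-1) G m
    + \sum_(2 <= i < N.+1) (sK i)^-1 * (Tq i (-1) G m - ymul i.-1 (Tq i (-1) G) m).

Definition is_fBToda (G : series) : Prop :=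
  (forall m, DBToda G m = (\sum_(1 <= i < N.+1) (sK i + (sK i)^-1)) * G m)
  /\ G [ffun=> 0%N] = 1.

(* Index data for the right-hand side: theta in Z_{>=0}^N and a matrix
   in M^(N) (indexing the terms of f^{A_{N-1} Toda}). *)
Definition vec_of (th : {ffun 'I_N -> nat}) (k : nat) : nat :=
  if (0 < k <= N)%N then th (inord k.-1) else 0%N.
Definition mat_of (t : {ffun 'I_N * 'I_N -> nat}) (i j : nat) : nat :=
  if (0 < i <= N)%N && (0 < j <= N)%N then t (inord i.-1, inord j.-1) else 0%N.

Definition strict_upper (t : {ffun 'I_N * 'I_N -> nat}) : bool :=
  [forall i : 'I_N, forall j : 'I_N, (j <= i)%N ==> (t (i, j) == 0%N)].

(* the monomial prod_i x_i^{-theta_i} * prod_{i<j} (x_j/x_i)^{t_{ij}}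
   equals y^m, compared via the exponents of x_1, ..., x_N *)
Definition mono_match (th : {ffun 'I_N -> nat}) (t : {ffun 'I_N * 'I_N -> nat})
    (m : mono) : bool :=
  [forall k : 'I_N,
     - (vec_of th k.+1)%:Z
     + (\sum_(1 <= i < k.+1) mat_of t i k.+1)%:Z
     - (\sum_(k.+2 <= j < N.+1) mat_of t k.+1 j)%:Z
     == xexp m k.+1].

(* coefficient of y^m in the (theta,t)-term of
   e_theta(s|q) * prod_i x_i^{-theta_i} * f^{A_{N-1}Toda}(x|q^{-theta}s|q) *)
Definition rhs_term (m : mono)
    (p : {ffun 'I_N -> nat} * {ffun 'I_N * 'I_N -> nat}) : Kfield :=
  let th := p.1 in let t := p.2 in
  if strict_upper t && mono_match th t m then
    eBA N (vec_of th) sK qK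
    * cToda N (mat_of t) (fun i => qK ^- (vec_of th i) * sK i) qK
  else 0.

End Toda.

(* Main.v *)
Require Import Defs.
From HB Require Import structures.
From mathcomp Require Import all_boot all_order all_algebra.
From mathcomp Require Import fraction mpoly.
From mathcomp Require Import zify ring.
From Stdlib Require Import FunctionalExtensionality.
Set Implicit Arguments.
Unset Strict Implicit.
Unset Printing Implicit Defensive.
Import Order.TTheory GRing.Theory Num.Theory.
Local Open Scope ring_scope.

(* Branching on the last column of theta writes f^{A_k} (k + 1 variables) as a
   sum over t in N^k of eA_t(s) prod_i (x_{k+1}/x_i)^{t_i} f^{A_{k-1}}(x|q^{-t} s),
   and the right-hand side of the theorem has the same shape with eA replaced
   by eB.  Everything then rests on the Pieri rules
     x_k^{-1} f(x|s)         = sum_i p_i(s) x_i^{-1} f(x|q^{-e_i} s),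
     s_k x_k^{-1} T_k f(x|s) = sum_i s_i p_i(s) x_i^{-1} f(x|q^{-e_i} s)
   for f = f^{A_{k-1}}: each Toda operator in one more variable (and the B
   operator) is an A operator in x_1, ..., x_k plus terms that they control, so
   an eigenvalue equation becomes a recursion for eA or eB.  Once the
   q-Pochhammer symbols cancel, with v_i = q^{-t_i} s_i, that recursion and the
   Pieri rules are instances of
     sum_i P(x_i) / prod_{j <> i} (x_i - x_j) = [z^{m-1}] (P mod prod_i (z - x_i))
   at m nodes x_i: the v_i (or 1/v_i, 1/s_i), possibly with the node 0, and the
   v_i + 1/v_i in type B.  Uniqueness holds because the diagonal coefficient of
   the B operator at a nonconstant monomial differs from the eigenvalue. *)

(** * Divided differences *)

(** Writing s_i = q^{lambda_i}, the function x^lambda f(x|s) is an eigenfunction of an operator free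
    of s, and multiplication by x_i^{-1} lowers lambda_i by one. Hence every shift q^{-t} s comes
    with the monomial x^{-t}, and an operator at s acts on the branch t as the same operator at v =
    q^{-t} s. Branches interact only through the boundary terms, which contain x_k^{-1}. A boundary
    term with T_k needs the weighted Pieri rule; one with the inverse shift of the new variable
    x_{k+1} needs the plain rule. The Pieri rules themselves need no induction: after both sides are
    expanded along the last column, every term carries some q^{-t} s in the function with one
    variable less, and only an identity between values of eA remains. The A operator and its dual
    are both required because the B operator is their sum minus s_N x_N^{-1} T_N. Series are handled
    as coefficient functions of integer exponent vectors, so every sum over t is finite: the
    exponents prescribe the sum of t. *)

Section DividedDifferences.
Variable F : fieldType.

(** Lagrange interpolation expresses [p] in the polynomials [ell i], all monic of degree m - 1, so
    the coefficient of degree m - 1 is the sum of the interpolation weights. *)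
Lemma lagrange_lead m (x : 'I_m -> F) (p : {poly F}) :
  injective x -> (size p <= m)%N ->
  \sum_i p.[x i] / \prod_(j | j != i) (x i - x j) = p`_m.-1.
Proof.
move=> x_inj sz_p.
have den0 i : \prod_(j | j != i) (x i - x j) != 0.
  apply/prodf_neq0 => j ji; rewrite subr_eq0; apply: contraNneq ji.
  by move/x_inj=> ->.
pose c i := p.[x i] / \prod_(j | j != i) (x i - x j).
pose ell i : {poly F} := \prod_(j | j != i) ('X - (x j)%:P).
have size_ell i : size (ell i) = m.
  rewrite /ell -big_filter size_prod_XsubC -sum1_size big_filter sum1_card.
  by rewrite (cardC1 i) card_ord prednK //; case: (m) i => // -[].
have pE : p = \sum_i c i *: ell i.
  apply/eqP; rewrite -subr_eq0; apply/eqP.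
  apply: (@roots_geq_poly_eq0 _ _ [seq x i | i <- enum 'I_m]).
  - apply/allP => _ /mapP [i _ ->]; rewrite rootE hornerD hornerN horner_sum.
    rewrite (bigD1 i) //= big1 ?addr0.
      rewrite hornerZ /c /ell horner_prod.
      under [X in _ - _ * X]eq_bigr do rewrite hornerXsubC.
      by rewrite divfK ?subrr.
    move=> j ji; rewrite hornerZ /ell horner_prod (bigD1 i) 1?eq_sym //=.
    by rewrite hornerXsubC subrr mul0r mulr0.
  - by rewrite map_inj_uniq ?enum_uniq.
  - rewrite size_map size_enum_ord (leq_trans (size_polyD _ _)) // geq_max sz_p.
    rewrite size_polyN (leq_trans (size_sum _ _ _)) //; apply/bigmax_leqP => i _.
    by rewrite (leq_trans (size_scale_leq _ _)) ?size_ell.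
rewrite {2}pE coef_sum; apply: eq_bigr => i _.
rewrite coefZ -/(c i); suff -> : (ell i)`_m.-1 = 1 by rewrite mulr1.
have /eqP := monic_prod_XsubC (index_enum 'I_m) (fun j => j != i) x.
by rewrite lead_coefE -/(ell i) size_ell.
Qed.

Lemma horner_prod_ord d (s : 'I_d -> F) z :
  (\prod_j ('X - (s j)%:P)).[z] = \prod_j (z - s j).
Proof. by rewrite horner_prod; apply: eq_bigr => j _; rewrite hornerXsubC. Qed.

Lemma size_prod_ord d (s : 'I_d -> F) : size (\prod_j ('X - (s j)%:P)) = d.+1.
Proof. by rewrite size_prod_XsubC -sum1_size sum1_card card_ord. Qed.

Lemma coef_prod_ord d (s : 'I_d.+1 -> F) :
  (\prod_j ('X - (s j)%:P))`_d = - \sum_j s j.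
Proof.
pose ps := [seq s j | j <- index_enum 'I_d.+1].
have szps : size ps = d.+1 by rewrite size_map -sum1_size sum1_card card_ord.
have := @coefPn_prod_XsubC F ps; rewrite szps /= => /(_ isT).
by rewrite !big_map.
Qed.

Lemma divdiff_low m d (x : 'I_m -> F) (s : 'I_d -> F) :
  injective x -> (d.+1 < m)%N ->
  \sum_i (\prod_j (x i - s j)) / \prod_(j | j != i) (x i - x j) = 0.
Proof.
move=> xI dm; have := @lagrange_lead m x (\prod_j ('X - (s j)%:P)) xI.
rewrite size_prod_ord ltnW // => /(_ isT).
rewrite nth_default ?size_prod_ord; last by lia.
by move=> sum0; rewrite -[RHS]sum0; apply: eq_bigr => i _; rewrite horner_prod_ord.
Qed.

Lemma divdiff_lead d (x : 'I_d.+1 -> F) (s : 'I_d -> F) :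
  injective x ->
  \sum_i (\prod_j (x i - s j)) / \prod_(j | j != i) (x i - x j) = 1.
Proof.
move=> xI; have := @lagrange_lead d.+1 x (\prod_j ('X - (s j)%:P)) xI.
rewrite size_prod_ord leqnn => /(_ isT) /=.
have /eqP := monic_prod_XsubC (index_enum 'I_d) predT s.
rewrite lead_coefE size_prod_ord /= => -> sum1; rewrite -[RHS]sum1.
by apply: eq_bigr => i _; rewrite horner_prod_ord.
Qed.

(** The numerator has degree m, one too many for interpolation. Subtracting the node polynomial
    changes no value at a node and cancels the leading term; the next coefficients are the root
    sums. *)
Lemma divdiff_sub m (x s : 'I_m -> F) :
  injective x ->
  \sum_i (\prod_j (x i - s j)) / \prod_(j | j != i) (x i - x j)
  = \sum_i x i - \sum_i s i.
Proof.
case: m x s => [|m] x s xI; first by rewrite !big_ord0 subrr.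
pose p := \prod_j ('X - (s j)%:P) - \prod_j ('X - (x j)%:P).
have szp : (size p <= m.+1)%N.
  apply/leq_sizeP => j mj; rewrite coefB.
  move: mj; rewrite leq_eqVlt => /predU1P [<-|mj].
    have /eqP := monic_prod_XsubC (index_enum 'I_m.+1) predT s.
    have /eqP := monic_prod_XsubC (index_enum 'I_m.+1) predT x.
    by rewrite !lead_coefE !size_prod_ord /= => -> ->; rewrite subrr.
  by rewrite !nth_default ?subrr ?size_prod_ord.
have := lagrange_lead xI szp; rewrite coefB !coef_prod_ord opprK addrC => <-.
apply: eq_bigr => i _; rewrite hornerD hornerN !horner_prod_ord.
by rewrite [X in _ - X](bigD1 i) //= subrr mul0r subr0.
Qed.

Lemma prod_ord_recr_neq k (i : 'I_k) (f : nat -> F) :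
  \prod_(j < k.+1 | j != i :> nat) f j = (\prod_(j < k | j != i) f j) * f k.
Proof.
rewrite big_mkcond big_ord_recr /= gtn_eqF // -big_mkcond /=.
by congr (_ * _); apply: eq_bigl.
Qed.

Lemma prod_ord_recr_last k (f : nat -> F) :
  \prod_(j < k.+1 | j != k :> nat) f j = \prod_(j < k) f j.
Proof.
rewrite big_mkcond big_ord_recr /= eqxx mulr1.
by apply: eq_bigr => j _; rewrite ltn_eqF.
Qed.

Definition distinct k (u : nat -> F) :=
  forall i j, (i < k)%N -> (j < k)%N -> u i = u j -> i = j.

(* The nodes u_0, ..., u_{k-1} together with the node 0. *)
Definition with_zero k (u : nat -> F) i := if (i < k)%N then u i else 0.

Lemma with_zero_inj k (u : nat -> F) :
  distinct k u -> (forall i, (i < k)%N -> u i != 0) ->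
  injective (fun i : 'I_k.+1 => with_zero k u i).
Proof.
move=> uI u0 i j; rewrite /with_zero; have := ltn_ord i; have := ltn_ord j.
rewrite !ltnS => jk ik; case: ltnP => ik'; case: ltnP => jk' => uij.
- exact/val_inj/uI.
- by move: (u0 i ik'); rewrite uij eqxx.
- by move: (u0 j jk'); rewrite -uij eqxx.
- by apply/val_inj/eqP; rewrite eqn_leq (leq_trans ik jk') (leq_trans jk ik').
Qed.

(** The node 0 puts an extra [u i] into every other denominator, and its own summand is the boundary
    term that later becomes a power of [q]. *)
Lemma sum_with_zero k (u : nat -> F) (P : F -> F) :
  \sum_(i < k.+1) P (with_zero k u i)
     / \prod_(j < k.+1 | j != i) (with_zero k u i - with_zero k u j)
  = \sum_(i < k) P (u i) / ((\prod_(j < k | j != i) (u i - u j)) * u i)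
    + P 0 / \prod_(j < k) (- u j).
Proof.
rewrite big_ord_recr /=; congr (_ + _).
  apply: eq_bigr => i _; rewrite {1 2}/with_zero ltn_ord.
  rewrite (prod_ord_recr_neq i (fun j => u i - with_zero k u j)).
  rewrite {2}/with_zero ltnn subr0; congr (_ / (_ * _)).
  by apply: eq_bigr => j _; rewrite /with_zero ltn_ord.
rewrite [with_zero k u k]/with_zero ltnn (prod_ord_recr_last k (fun j => 0 - with_zero k u j)).
by congr (_ / _); apply: eq_bigr => j _; rewrite /with_zero ltn_ord sub0r.
Qed.

Lemma divdiff_sub0 k (u t : nat -> F) :
  distinct k u -> (forall i, (i < k)%N -> u i != 0) ->
  \sum_(i < k) (\prod_(j < k.+1) (u i - t j))
     / ((\prod_(j < k | j != i) (u i - u j)) * u i)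
  + (\prod_(j < k.+1) (- t j)) / \prod_(j < k) (- u j)
  = \sum_(i < k) u i - \sum_(j < k.+1) t j.
Proof.
move=> uI u0; have := @divdiff_sub k.+1 _ (fun j => t j) (with_zero_inj uI u0).
rewrite (sum_with_zero k u (fun z => \prod_(j < k.+1) (z - t j))).
rewrite [X in _ = X - _]big_ord_recr /= {2}/with_zero ltnn addr0.
under [X in _ = X - _]eq_bigr do rewrite /with_zero ltn_ord.
by move=> <-; congr (_ + _ / _); apply: eq_bigr => j _; rewrite sub0r.
Qed.

Lemma divdiff_low0 k (u t : nat -> F) :
  distinct k.+1 u -> (forall i, (i < k.+1)%N -> u i != 0) ->
  \sum_(i < k.+1) (\prod_(j < k) (u i - t j))
     / ((\prod_(j < k.+1 | j != i) (u i - u j)) * u i)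
  + (\prod_(j < k) (- t j)) / \prod_(j < k.+1) (- u j) = 0.
Proof.
move=> uI u0.
have := divdiff_low (fun j : 'I_k => t j) (with_zero_inj uI u0) (leqnn _).
rewrite (sum_with_zero k.+1 u (fun z => \prod_(j < k) (z - t j))).
move=> sum0; rewrite -[RHS]sum0.
by congr (_ + _ / _); apply: eq_bigr => j _; rewrite sub0r.
Qed.

End DividedDifferences.

(** * Weights and the A-type eigenvalue equations *)

Section Weights.
Variables (F : fieldType) (q : F).
Hypothesis q0 : q != 0.
Hypothesis q_unity : forall m, (0 < m)%N -> q ^+ m != 1.

Lemma qpochSr a m : qpoch q a m.+1 = qpoch q a m * (1 - q ^+ m * a).
Proof. by rewrite /qpoch big_ord_recr. Qed.

Lemma qpochSl a m : qpoch q a m.+1 = (1 - a) * qpoch q (q * a) m.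
Proof.
rewrite /qpoch big_ord_recl expr0 mul1r; congr (_ * _).
by apply: eq_bigr => i _; rewrite mulrA -exprSr.
Qed.

Lemma qpoch_neq0 a m :
  (forall l, (l < m)%N -> q ^+ l * a != 1) -> qpoch q a m != 0.
Proof.
by move=> ha; apply/prodf_neq0 => l _; rewrite subr_eq0 eq_sym ha.
Qed.

Definition qshift (s : nat -> F) (t : nat -> nat) i := q ^- t i * s i.
Definition incr (t : nat -> nat) (i j : nat) := ((i == j) + t j)%N.
Definition unitv (i j : nat) : nat := (i == j).

(** The exponent [z] ranges over all integers to make the condition stable under [qshift], where
    ratios of parameters move by powers of [q] of either sign. *)
Definition generic k (s : nat -> F) :=
  (forall i, (i < k)%N -> s i != 0) /\
  (forall i j (z : int), (i < k)%N -> (j < k)%N -> i != j -> q ^ z * s i != s j).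

Lemma generic_qshift k s t : generic k s -> generic k (qshift s t).
Proof.
case=> s0 sz; split=> [i ik|i j z ik jk ij].
  by rewrite mulf_neq0 ?s0 // invr_eq0 expf_neq0.
rewrite /qshift; apply: contraNneq (sz i j (z - (t i)%:Z + (t j)%:Z) ik jk ij).
move=> /(congr1 (fun x => q ^+ t j * x)); rewrite mulVKf ?expf_neq0 // => <-.
by rewrite !expfzDr // exprnN -!exprnP; apply/eqP; ring.
Qed.

Lemma generic_leq k k' s : (k <= k')%N -> generic k' s -> generic k s.
Proof.
move=> kk' [s0 sz]; split=> [i ik|i j z ik jk]; first by rewrite s0 ?(leq_trans ik).
by apply: sz; [rewrite (leq_trans ik)|rewrite (leq_trans jk)].
Qed.

Lemma generic_ratio k s i j l : generic k s ->
  (i < k)%N -> (j < k)%N -> i != j -> q ^+ l * (s i / s j) != 1.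
Proof.
case=> s0 sz ik jk ij; apply: contraNneq (sz i j l ik jk ij) => h; apply/eqP.
by rewrite -exprnP -[RHS]mul1r -h -mulrA divfK ?s0.
Qed.

Lemma generic_ratio1 k s i j : generic k s ->
  (i < k)%N -> (j < k)%N -> i != j -> s i / s j != 1.
Proof. by move=> gs ik jk ij; have := generic_ratio 0 gs ik jk ij; rewrite mul1r. Qed.

Lemma generic_distinct k s : generic k s -> distinct k s.
Proof.
case=> s0 sz i j ik jk sij; apply/eqP; case: eqVneq => // ij.
by have := sz i j 0 ik jk ij; rewrite expr0z mul1r sij eqxx.
Qed.

(** Diagonal entries hold the factors of a single index, entries above the diagonal those of a pair,
    and the rest are 1. In this layout a change of [t i] affects only row and column [i]. The powers
    of [q] are spread over row [i], one for each j >= i. *)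
Definition wA s t i j : F :=
  if i == j then q ^+ t i / qpoch q q (t i) else
  if (i < j)%N then
    q ^+ t i / (qpoch q (q * (s j / s i)) (t i)
                * qpoch q (q * (qshift s t i / qshift s t j)) (t i))
  else 1.

Definition wB s t i j : F :=
  if i == j then (qpoch q (q / s i ^+ 2) (t i))^-1 else
  if (i < j)%N then
    qpoch q (q / (s i * s j)) (t i + t j)
    / (qpoch q (q / (s i * s j)) (t i) * qpoch q (q / (s i * s j)) (t j))
  else 1.

Definition WA k s t := \prod_(i < k) \prod_(j < k) wA s t i j.
Definition WB k s t := \prod_(i < k) \prod_(j < k) wB s t i j.
Definition eA k s t := WA k s t * \prod_(i < k) (qpoch q (q * (s k / s i)) (t i))^-1.
Definition eB k s t := WA k s t * WB k s t.

(* Pieri coefficient: x_k^{-1} f(x|s) = sum_i pieri k s i x_i^{-1} f(x|q^{-e_i} s). *)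
Definition pieri1 s i j : F :=
  if (i < j)%N then - (q * (s j / s i)) / ((1 - s j / s i) * (1 - q * (s j / s i)))
  else 1.
Definition pieri k s i := \prod_(j < k) pieri1 s i j.

(** Everything outside row and column [i] cancels. Entries (i, j) and (j, i) are compared as a pair
    because only one of them is nontrivial, and which one depends on the order of [i] and [j]. *)
Lemma prod_pair_update k (i : 'I_k) (w w' : nat -> nat -> F) (b r : nat -> F) :
  (forall a c : nat, a != i -> c != i -> w a c = w' a c) ->
  (forall j : nat, (j < k)%N -> j != i -> w i j * w j i * b j = w' i j * w' j i * r j) ->
  w i i * b i = w' i i * r i ->
  (\prod_(a < k) \prod_(c < k) w a c) * \prod_(j < k) b j
  = (\prod_(a < k) \prod_(c < k) w' a c) * \prod_(j < k) r j.
Proof.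
have split_i (u : nat -> nat -> F) (x : nat -> F) :
    (\prod_(a < k) \prod_(c < k) u a c) * \prod_(j < k) x j
    = u i i * x i * \prod_(j < k | j != i) (u i j * u j i * x j)
      * \prod_(a < k | a != i) \prod_(c < k | c != i) u a c.
  have -> : \prod_(a < k) \prod_(c < k) u a c
    = u i i * \prod_(c < k | c != i) u i c * (\prod_(a < k | a != i) u a i
      * \prod_(a < k | a != i) \prod_(c < k | c != i) u a c).
    rewrite (bigD1 i) //= (bigD1 i) //= -big_split; congr (_ * _).
    by apply: eq_bigr => a _; rewrite (bigD1 i).
  by rewrite [\prod_(j < k) x j](bigD1 i) //= !big_split /=; ring.
move=> out pr dg; rewrite !split_i dg; congr (_ * _ * _).
  by apply: eq_bigr => j ji; rewrite pr.
by apply: eq_bigr => a ai; apply: eq_bigr => c ci; rewrite out.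
Qed.

Lemma prod_update k (i : 'I_k) (w w' : nat -> F) r :
  (forall a : nat, a != i -> w a = w' a) -> w i = w' i * r ->
  \prod_(a < k) w a = (\prod_(a < k) w' a) * r.
Proof.
move=> out dg; rewrite (bigD1 i) //= [in RHS](bigD1 i) //= dg mulrAC.
by congr (_ * _ * _); apply: eq_bigr => a ai; rewrite out.
Qed.

Lemma incr_id t i : incr t i i = (t i).+1.
Proof. by rewrite /incr eqxx. Qed.

Lemma incr_neq t i j : j != i -> incr t i j = t j.
Proof. by rewrite /incr eq_sym => /negbTE ->. Qed.

Lemma qshift_incr_id s t i : qshift s (incr t i) i = q^-1 * qshift s t i.
Proof. by rewrite /qshift incr_id exprS invfM mulrA. Qed.

Lemma qshift_incr_neq s t i j : j != i -> qshift s (incr t i) j = qshift s t j.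
Proof. by move=> ji; rewrite /qshift incr_neq. Qed.

Lemma qshift_unitv s t i : qshift (qshift s (unitv i)) t = qshift s (incr t i).
Proof.
apply: functional_extensionality => j; rewrite /qshift /unitv /incr.
by rewrite exprD invfM mulrA [_^-1 * _^-1]mulrC.
Qed.

Lemma qshift_unitv_id s i : qshift s (unitv i) i = q^-1 * s i.
Proof. by rewrite /qshift /unitv eqxx expr1. Qed.

Lemma qshift_unitv_neq s i j : j != i -> qshift s (unitv i) j = s j.
Proof. by rewrite eq_sym /qshift /unitv => /negbTE ->; rewrite expr0 invr1 mul1r. Qed.

Lemma qpoch_qq_neq0 m : qpoch q q m != 0.
Proof. by apply: qpoch_neq0 => l _; rewrite -exprSr q_unity. Qed.

Lemma qpoch_ratio_neq0 k s i j m : generic k s ->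
  (i < k)%N -> (j < k)%N -> i != j -> qpoch q (q * (s i / s j)) m != 0.
Proof.
move=> gs ik jk ij; apply: qpoch_neq0 => l _.
by rewrite mulrA -exprSr (generic_ratio _ gs).
Qed.

(* The factor by which the weight at t - e_i differs from the weight at t, after
   multiplication by a Pieri coefficient; v is q^{-t} s. *)
Definition rho1 (s v : nat -> F) i j :=
  if i == j then 1 - s i / v i else (1 - s j / v i) / (1 - v j / v i).
Definition rho2 (s v : nat -> F) i j :=
  if i == j then 1 - s i / v i else (1 - s i / v j) / (1 - s i / s j).

Lemma qpoch_shift a m : a != 1 ->
  qpoch q (q * a) m = qpoch q a m * (1 - q ^+ m * a) / (1 - a).
Proof.
move=> a1; rewrite -qpochSr qpochSl mulrAC divff ?mul1r //.
by rewrite subr_eq0 eq_sym.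
Qed.

(** Here [s] stays fixed and the Pieri coefficient is taken at the shifted parameters: the form
    needed when a Pieri rule is applied inside a branch. The factor [q] comes from the diagonal
    weight. *)
Lemma WA_incr k s (t : nat -> nat) (i : 'I_k) : generic k s ->
  WA k s t * pieri k (qshift s t) i * q
  = WA k s (incr t i) * \prod_(j < k) rho1 s (qshift s (incr t i)) i j.
Proof.
move=> gs; have gt := generic_qshift t gs; have gt' := generic_qshift (incr t i) gs.
have ik := ltn_ord i; have [s0 _] := gs; have [t0 _] := gt.
pose b (j : nat) := if j == i then q else pieri1 (qshift s t) i j.
have -> : WA k s t * pieri k (qshift s t) i * q = WA k s t * \prod_(j < k) b j.
  rewrite -mulrA; congr (_ * _); rewrite /pieri (bigD1 i) //= {1}/pieri1 ltnn mul1r.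
  rewrite [RHS](bigD1 i) //= {1}/b eqxx mulrC; congr (_ * _).
  by apply: eq_bigr => j ji; rewrite /b ifN.
apply: (@prod_pair_update k i (wA s t) (wA s (incr t i)) b
  (rho1 s (qshift s (incr t i)) i)) => [a c ai ci|j jk ji|].
- by rewrite /wA !incr_neq // !qshift_incr_neq.
- have ij : (i : nat) == j = false by rewrite eq_sym (negbTE ji).
  rewrite /b /rho1 (negbTE ji) ij /wA !(negbTE ji) ij /pieri1.
  have [lij|] := ltnP i j.
    rewrite ltnNge (ltnW lij) /= !mulr1 incr_id qshift_incr_id qshift_incr_neq //.
    (* Both symbols gain a factor, at the top for the first; the argument of the second is also
       divided by [q], so its new factor is at the bottom. *)
    rewrite qpochSr [qpoch q (q * (q^-1 * _ / _)) _.+1]qpochSl.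
    have := qpoch_ratio_neq0 (t i) gs jk ik ji.
    have := qpoch_ratio_neq0 (t i) gt ik jk (negbT ij).
    have := generic_ratio (t i).+1 gs jk ik ji.
    have := generic_ratio 1 gt jk ik ji.
    have := generic_ratio1 gt ik jk (negbT ij).
    have := t0 _ ik; have := t0 _ jk; have := s0 _ ik.
    have -> : q * (q^-1 * qshift s t i / qshift s t j) = qshift s t i / qshift s t j.
      by field; rewrite q0 t0.
    have -> : s j / (q^-1 * qshift s t i) = q ^+ (t i).+1 * (s j / s i).
      by rewrite /qshift exprS; field; rewrite q0 s0 // expf_neq0.
    set A := qpoch _ _ _; set C := qpoch _ _ _.
    rewrite expr1 exprS; set Q := q ^+ t i; move: (qshift s t i) (qshift s t j).
    move=> Vi Vj si0 Vj0 Vi0 h1 h2 h3 C0 A0.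
    have e1 : Vi - Vj != 0.
      rewrite subr_eq0; apply: contraNneq h1 => ->; rewrite divff //.
    have e2 : Vi - q * Vj != 0.
      rewrite subr_eq0; apply: contraNneq h2 => ->.
      by apply/eqP; field; rewrite q0 Vj0.
    have e3 : s i - q * Q * s j != 0.
      rewrite subr_eq0; apply: contraNneq h3 => h; apply/eqP.
      by rewrite mulrA -h divff.
    field; rewrite ?q0 ?Vi0 ?Vj0 ?A0 ?C0 ?si0 ?e1 ?e2 ?e3 /=.
    by rewrite [Vj * q]mulrC e2 -[Vj - Vi]opprB oppr_eq0 e1 mulrCA mulrA e3.
  rewrite leq_eqVlt (negbTE ji) /= => lji.
  rewrite lji !mul1r !mulr1 incr_neq // qshift_incr_id qshift_incr_neq //.
  have -> : q * (qshift s t j / (q^-1 * qshift s t i))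
          = q * (q * (qshift s t j / qshift s t i)).
    by field; rewrite q0 t0.
  (* For j < i the length [t j] is unchanged and only the argument moves, by one factor [q]; the
     Pieri factor is 1. *)
  rewrite [qpoch q (q * (q * _)) _]qpoch_shift; last first.
    by have := generic_ratio 1 gt jk ik ji; rewrite expr1.
  have := qpoch_ratio_neq0 (t j) gs ik jk (negbT ij).
  have := qpoch_ratio_neq0 (t j) gt jk ik ji.
  have := generic_ratio (t j).+1 gt jk ik ji.
  have := generic_ratio 1 gt jk ik ji.
  have -> : qshift s t j / (q^-1 * qshift s t i) = q * (qshift s t j / qshift s t i).
    by field; rewrite q0 t0.
  have -> : s j / (q^-1 * qshift s t i)
          = q ^+ t j * (q * (qshift s t j / qshift s t i)).
    have := t0 _ ik; rewrite [qshift s t j]/qshift; set x := qshift _ _ i => x0.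
    by field; rewrite q0 x0 expf_neq0.
  rewrite expr1 exprSr -[_ * q * _]mulrA; set x := q * (qshift s t j / _).
  move=> h1 h2 A0 C0.
  have e1 : 1 - x != 0 by rewrite subr_eq0 eq_sym.
  have e2 : 1 - q ^+ t j * x != 0 by rewrite subr_eq0 eq_sym.
  by field; rewrite A0 C0 e1 e2.
- rewrite /b /rho1 /wA !eqxx incr_id qshift_incr_id qpochSr.
  have -> : s i / (q^-1 * qshift s t i) = q ^+ t i * q.
    by rewrite /qshift; field; rewrite q0 s0 ?ltn_ord // expf_neq0.
  have P0 := qpoch_qq_neq0 (t i).
  have e1 : 1 - q ^+ t i * q != 0 by rewrite subr_eq0 eq_sym -exprSr q_unity.
  by rewrite exprS; field; rewrite P0 e1.
Qed.

(** Here the parameters of the weight themselves move to q^{-e_i} s, as happens when the terms of a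
    Pieri rule are branched. Both sides share the shifted parameters q^{-(t + e_i)} s. *)
Lemma WA_unitv k s (t : nat -> nat) (i : 'I_k) : generic k s ->
  WA k (qshift s (unitv i)) t * pieri k s i * q
  = WA k s (incr t i) * \prod_(j < k) rho2 s (qshift s (incr t i)) i j.
Proof.
move=> gs; have gt' := generic_qshift (incr t i) gs.
have gu := generic_qshift (unitv i) gs.
have ik := ltn_ord i; have [s0 _] := gs; have [t0 _] := gt'.
pose b (j : nat) := if j == i then q else pieri1 s i j.
have -> : WA k (qshift s (unitv i)) t * pieri k s i * q
        = WA k (qshift s (unitv i)) t * \prod_(j < k) b j.
  rewrite -mulrA; congr (_ * _); rewrite /pieri (bigD1 i) //= {1}/pieri1 ltnn mul1r.
  rewrite [RHS](bigD1 i) //= {1}/b eqxx mulrC; congr (_ * _).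
  by apply: eq_bigr => j ji; rewrite /b ifN.
apply: (@prod_pair_update k i (wA (qshift s (unitv i)) t) (wA s (incr t i)) b
  (rho2 s (qshift s (incr t i)) i)) => [a c ai ci|j jk ji|].
- by rewrite /wA qshift_unitv !incr_neq // !qshift_unitv_neq.
- have ij : (i : nat) == j = false by rewrite eq_sym (negbTE ji).
  rewrite /b /rho2 (negbTE ji) ij /wA !(negbTE ji) ij /pieri1 qshift_unitv.
  have [lij|] := ltnP i j.
    rewrite ltnNge (ltnW lij) /= !mulr1 incr_id qshift_unitv_id qshift_unitv_neq //.
    rewrite [qpoch q (q * (s j / s i)) _.+1]qpochSl qpochSr.
    have := qpoch_ratio_neq0 (t i) gt' ik jk (negbT ij).
    have := qpoch_ratio_neq0 (t i) gu jk ik ji.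
    have := generic_ratio (t i).+1 gt' ik jk (negbT ij).
    have := generic_ratio 1 gs jk ik ji.
    have := generic_ratio1 gs jk ik ji.
    rewrite qshift_unitv_id qshift_unitv_neq //.
    have -> : q * (s j / (q^-1 * s i)) = q * (q * (s j / s i)).
      by field; rewrite q0 s0.
    have -> : s i / qshift s (incr t i) j
      = q ^+ t i * (q * (qshift s (incr t i) i / qshift s (incr t i) j)).
      have := t0 _ jk; rewrite {3}/qshift incr_id exprS; set x := qshift _ _ _ => x0.
      by field; rewrite q0 x0 expf_neq0.
    rewrite expr1 exprSr -[_ * q * _]mulrA; set x := q * (_ / _).
    set A := qpoch _ _ _; set C := qpoch _ _ _ => h1 h2 h3 A0 C0.
    have e1 : s i - s j != 0.
      by rewrite subr_eq0; apply: contraNneq h1 => ->; rewrite divff // s0.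
    have e2 : s i - q * s j != 0.
      rewrite subr_eq0; apply: contraNneq h2 => h.
      by rewrite mulrA -h divff // s0.
    have e3 : 1 - q ^+ t i * x != 0 by rewrite subr_eq0 eq_sym.
    field; rewrite ?A0 ?C0 ?s0 // ?e1 ?e2 ?e3 /=.
    by rewrite -opprB oppr_eq0 e1.
  rewrite leq_eqVlt (negbTE ji) /= => lji.
  rewrite lji !mul1r !mulr1 incr_neq // qshift_unitv_id qshift_unitv_neq //.
  rewrite [qpoch q (q * (s i / s j)) _]qpoch_shift; last first.
    exact: (generic_ratio1 gs ik jk (negbT ij)).
  have := qpoch_ratio_neq0 (t j) gu ik jk (negbT ij).
  rewrite qshift_unitv_id qshift_unitv_neq //.
  have -> : q * (q^-1 * s i / s j) = s i / s j by field; rewrite q0 s0.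
  have -> : s i / qshift s (incr t i) j = q ^+ t j * (s i / s j).
    by rewrite qshift_incr_neq // /qshift; field; rewrite s0 // expf_neq0.
  have := qpoch_ratio_neq0 (t j) gt' jk ik ji.
  have := generic_ratio (t j) gs ik jk (negbT ij).
  have := generic_ratio1 gs ik jk (negbT ij).
  set x := s i / s j => h1 h2 A0 C0.
  have e1 : 1 - x != 0 by rewrite subr_eq0 eq_sym.
  have e2 : 1 - q ^+ t j * x != 0 by rewrite subr_eq0 eq_sym.
  by field; rewrite A0 C0 e1 e2.
- rewrite /b /rho2 /wA !eqxx incr_id qshift_incr_id qpochSr.
  have -> : s i / (q^-1 * qshift s t i) = q ^+ t i * q.
    by rewrite /qshift; field; rewrite q0 s0 ?ltn_ord // expf_neq0.
  have P0 := qpoch_qq_neq0 (t i).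
  have e1 : 1 - q ^+ t i * q != 0 by rewrite subr_eq0 eq_sym -exprSr q_unity.
  by rewrite exprS; field; rewrite P0 e1.
Qed.

Lemma WA_ext k s s' t : (forall i, (i < k)%N -> s i = s' i) ->
  WA k s t = WA k s' t.
Proof.
move=> ss'; apply: eq_bigr => i _; apply: eq_bigr => j _.
by rewrite /wA /qshift !ss' ?ltn_ord.
Qed.

Lemma eA_incr k s (t : nat -> nat) (i : 'I_k) : generic k.+1 s ->
  eA k s t * pieri k (qshift s t) i * q
  = eA k s (incr t i) * ((\prod_(j < k) rho1 s (qshift s (incr t i)) i j)
                         * (1 - s k / qshift s (incr t i) i)).
Proof.
move=> gs; have gs' := generic_leq (leqnSn k) gs; have [s0 _] := gs'.
have ik : (i < k.+1)%N by rewrite ltnS ltnW.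
have ki : k != i by rewrite gtn_eqF.
pose X := \prod_(a < k) (qpoch q (q * (s k / s a)) (incr t i a))^-1.
have -> : eA k s t = WA k s t * (X * (1 - s k / qshift s (incr t i) i)).
  congr (_ * _).
  apply: (@prod_update k i (fun a => (qpoch q (q * (s k / s a)) (t a))^-1)
    (fun a => (qpoch q (q * (s k / s a)) (incr t i a))^-1)) => [a ai|].
    by rewrite incr_neq.
  rewrite incr_id qpochSr.
  have -> : s k / qshift s (incr t i) i = q ^+ t i * (q * (s k / s i)).
    by rewrite /qshift incr_id exprS; field; rewrite q0 s0 ?expf_neq0.
  rewrite invfM mulfVK // subr_eq0 eq_sym mulrA -exprSr.
  exact: generic_ratio gs _ _ ki.
rewrite /eA -/X [RHS]mulrACA -WA_incr //; ring.
Qed.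

Lemma eA_unitv k s (t : nat -> nat) (i : 'I_k) : generic k.+1 s ->
  eA k (qshift s (unitv i)) t * pieri k.+1 s i
  = eA k s (incr t i) * ((\prod_(j < k) rho2 s (qshift s (incr t i)) i j)
                         / (1 - s i / s k)).
Proof.
move=> gs; have gs' := generic_leq (leqnSn k) gs; have [s0 _] := gs.
have ik : (i < k.+1)%N by rewrite ltnS ltnW.
have ki : k != i by rewrite gtn_eqF.
have h1 : 1 - q * (s k / s i) != 0.
  by rewrite subr_eq0 eq_sym -[q]expr1 (generic_ratio 1 gs).
pose X := \prod_(a < k) (qpoch q (q * (s k / s a)) (incr t i a))^-1.
have -> : eA k (qshift s (unitv i)) t
        = WA k (qshift s (unitv i)) t * (X * (1 - q * (s k / s i))).
  congr (_ * _); pose u := qshift s (unitv i).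
  apply: (@prod_update k i (fun a => (qpoch q (q * (u k / u a)) (t a))^-1)
    (fun a => (qpoch q (q * (s k / s a)) (incr t i a))^-1)) => [a ai|].
    by rewrite incr_neq // /u !qshift_unitv_neq.
  rewrite /u incr_id qpochSl qshift_unitv_id qshift_unitv_neq //.
  have -> : q * (s k / (q^-1 * s i)) = q * (q * (s k / s i)).
    by field; rewrite q0 s0.
  by rewrite invfM mulrAC mulVf // mul1r.
rewrite /pieri big_ord_recr /= -/(pieri k s i) {1}/pieri1 ltn_ord.
have h2 : s i - s k != 0.
  rewrite subr_eq0; apply: contraNneq ki => sik; apply/eqP.
  by apply: (generic_distinct gs).
(* The Pieri factor of the pair (i, k): its denominator 1 - q s_k / s_i cancels against the factor
   just split off from [eA]. *)
have -> : - (q * (s k / s i)) / ((1 - s k / s i) * (1 - q * (s k / s i)))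
        = q / (1 - s i / s k) / (1 - q * (s k / s i)).
  have h3 : s i - q * s k != 0.
    rewrite subr_eq0; apply: contraNneq h1 => h.
    by rewrite subr_eq0 mulrA -h divff ?s0.
  by field; rewrite !s0 // h3 h2 -opprB oppr_eq0 h2.
rewrite /eA -/X [RHS]mulrACA -WA_unitv //.
move: h1; set y := q * (s k / s i) => h1; rewrite [X * (1 - y)]mulrC; field.
by rewrite h1 s0 //= -opprB oppr_eq0 h2.
Qed.

Lemma eA_unitv_last k s (t : nat -> nat) : generic k.+1 s ->
  eA k (qshift s (unitv k)) t
  = eA k s t * \prod_(j < k) ((1 - s k / qshift s t j) / (1 - s k / s j)).
Proof.
move=> gs; have [s0 _] := gs.
rewrite /eA (@WA_ext k _ s) => [|i ik]; last by rewrite qshift_unitv_neq ?ltn_eqF.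
rewrite -mulrA; congr (_ * _); rewrite -big_split; apply: eq_bigr => j _ /=.
have jk : (j < k.+1)%N by rewrite ltnS ltnW.
have kj : k != j by rewrite gtn_eqF.
rewrite qshift_unitv_id qshift_unitv_neq 1?eq_sym //.
have -> : q * (q^-1 * s k / s j) = s k / s j by field; rewrite q0 s0.
have h1 := generic_ratio1 gs (ltnSn k) jk kj.
have -> : s k / qshift s t j = q ^+ t j * (s k / s j).
  by rewrite /qshift; field; rewrite s0 ?expf_neq0.
have h2 := generic_ratio (t j) gs (ltnSn k) jk kj.
rewrite qpoch_shift //; set P := qpoch _ _ _.
(* For [P = 0] both sides are 0, since the inverse of 0 is 0. *)
have [-> |P0] := eqVneq P 0; first by rewrite !mul0r !invr0 mul0r.
have e1 : 1 - s k / s j != 0 by rewrite subr_eq0 eq_sym.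
have e2 : 1 - q ^+ t j * (s k / s j) != 0 by rewrite subr_eq0 eq_sym.
by move: e1 e2; set x := s k / s j => e1 e2; field; rewrite P0 e1 e2.
Qed.

(** The case i = j is included, for the symbols in q / s_i^2. *)
Definition generic2 k (s : nat -> F) :=
  forall i j l, (i < k)%N -> (j < k)%N -> q ^+ l / (s i * s j) != 1.

Definition rhoB (s v : nat -> F) i j :=
  if i == j then 1 - 1 / (s i * v i) else (1 - 1 / (s j * v i)) / (1 - 1 / (v i * v j)).

Lemma WB_incr k s (t : nat -> nat) (i : 'I_k) : generic k s -> generic2 k s ->
  WB k s t = WB k s (incr t i) * \prod_(j < k) rhoB s (qshift s (incr t i)) i j.
Proof.
move=> gs g2; have [s0 _] := gs; have ik := ltn_ord i.
have P0 a c m : (a < k)%N -> (c < k)%N -> qpoch q (q / (s a * s c)) m != 0.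
  by move=> ak ck; apply: qpoch_neq0 => l _; rewrite mulrA -exprSr g2.
rewrite -[LHS]mulr1 -[X in _ * X = _](_ : \prod_(j < k) (fun=> 1) j = 1); last exact: big1.
apply: (@prod_pair_update k i (wB s t) (wB s (incr t i)) (fun=> 1)
  (rhoB s (qshift s (incr t i)) i)) => [a c ai ci|j jk ji|].
- by rewrite /wB !incr_neq.
- have ij : (i : nat) == j = false by rewrite eq_sym (negbTE ji).
  have -> : wB s t i j * wB s t j i =
     qpoch q (q / (s i * s j)) (t i + t j)
     / (qpoch q (q / (s i * s j)) (t i) * qpoch q (q / (s i * s j)) (t j)).
    rewrite /wB (negbTE ji) ij; case: ltngtP ij => // _ _; rewrite ?mulr1 ?mul1r //.
    by rewrite [s j * s i]mulrC [(t j + t i)%N]addnC [X in _ / X = _]mulrC.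
  have -> : wB s (incr t i) i j * wB s (incr t i) j i =
     qpoch q (q / (s i * s j)) (t i + t j).+1
     / (qpoch q (q / (s i * s j)) (t i).+1 * qpoch q (q / (s i * s j)) (t j)).
    rewrite /wB (negbTE ji) ij incr_id incr_neq //.
    case: ltngtP ij => // _ _; rewrite ?mulr1 ?mul1r //.
    by rewrite [s j * s i]mulrC addnS [(t j + _)%N]addnC [X in _ / X = _]mulrC.
  rewrite /rhoB ij qshift_incr_id qshift_incr_neq //.
  have -> : 1 / (s j * (q^-1 * qshift s t i)) = q ^+ t i * (q / (s i * s j)).
    by rewrite /qshift; field; rewrite q0 !s0 ?expf_neq0.
  have -> : 1 / (q^-1 * qshift s t i * qshift s t j)
          = q ^+ (t i + t j) * (q / (s i * s j)).
    by rewrite /qshift exprD; field; rewrite q0 !s0 ?expf_neq0.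
  rewrite !qpochSr.
  have e1 : 1 - q ^+ t i * (q / (s i * s j)) != 0.
    by rewrite subr_eq0 eq_sym mulrA -exprSr g2.
  have e2 : 1 - q ^+ (t i + t j) * (q / (s i * s j)) != 0.
    by rewrite subr_eq0 eq_sym mulrA -exprSr g2.
  have := P0 _ _ (t i) ik jk; have := P0 _ _ (t j) ik jk; move: e1 e2.
  set z := q / _ => e1 e2 A0 C0; field.
  by rewrite A0 C0 e1 e2.
- rewrite /rhoB /wB !eqxx incr_id qpochSr mulr1.
  have -> : 1 / (s i * qshift s (incr t i) i) = q ^+ t i * (q / s i ^+ 2).
    by rewrite /qshift incr_id exprS; field; rewrite q0 !s0 ?expf_neq0.
  rewrite [(_ * (1 - _))^-1]invfM mulfVK // subr_eq0 eq_sym mulrA -exprSr expr2; exact: g2.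
Qed.

Lemma eB_incr k s (t : nat -> nat) (i : 'I_k) : generic k s -> generic2 k s ->
  eB k s t * pieri k (qshift s t) i * q
  = eB k s (incr t i) * \prod_(j < k) (rho1 s (qshift s (incr t i)) i j
                                       * rhoB s (qshift s (incr t i)) i j).
Proof.
move=> gs g2; rewrite /eB (WB_incr t i gs g2) big_split /=.
by rewrite [RHS]mulrACA -WA_incr //; ring.
Qed.

(** * Summation identities for the weight ratios *)

(** The nodes are the v_i and 0, and the numerator is the product of the z - s_j over j <= k; the
    node 0 gives s_k times the product of the s_i / v_i. In the recursion for [eA] the first sum on
    the right is the difference of the eigenvalues at v and at s. *)
Lemma sum_rho1 k (s v : nat -> F) :
  distinct k v -> (forall i, (i < k)%N -> v i != 0) ->
  \sum_(i < k) v i * ((\prod_(j < k) rho1 s v i j) * (1 - s k / v i))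
  = \sum_(i < k) (v i - s i) + s k * (\prod_(i < k) (s i / v i) - 1).
Proof.
move=> vI v0; have := @divdiff_sub0 F k v s vI v0.
have -> : \prod_(j < k.+1) - s j / \prod_(j < k) - v j
        = - (s k * \prod_(i < k) (s i / v i)).
  rewrite big_ord_recr /= mulrAC -prodf_div mulrN mulrC; congr (- (_ * _)).
  by apply: eq_bigr => i _; rewrite invrN mulrNN.
rewrite [in X in _ -> X]sumrB big_ord_recr /= => /(canRL (addrK _)).
rewrite opprK => sumE; transitivity (\sum_(i < k) v i -
   (\sum_(i < k) s i + s k) + s k * \prod_(i < k) (s i / v i)); last by ring.
rewrite -sumE; apply: eq_bigr => i _; rewrite big_ord_recr /=.
rewrite (bigD1 i) //= [in RHS](bigD1 i) //= {1}/rho1 eqxx.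
have -> : \prod_(j < k | j != i) rho1 s v i j =
  \prod_(j < k | j != i) (v i - s j) / \prod_(j < k | j != i) (v i - v j).
  rewrite -prodf_div; apply: eq_bigr => j ji; rewrite /rho1 ifN 1?eq_sym //.
  have e : v i - v j != 0.
    by rewrite subr_eq0; apply: contraNneq ji => vij; apply/eqP/esym/val_inj/(vI _ _ (ltn_ord i) (ltn_ord j)).
  by field; rewrite v0 ?e.
have vd : \prod_(j < k | j != i) (v i - v j) != 0.
  apply/prodf_neq0 => j ji.
  by rewrite subr_eq0; apply: contraNneq ji => vij; apply/eqP/esym/val_inj/(vI _ _ (ltn_ord i) (ltn_ord j)).
by field; rewrite v0 ?vd.
Qed.

(** The same computation with inverted nodes 1 / v_i. The multiplier on the left, which will be the
    boundary coefficient s_k^{-1} q^{-a_k}, turns the factors of [rho1] into quotients of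
    differences of inverses. *)
Lemma sum_rho1_inv k (s v : nat -> F) :
  distinct k v -> (forall i, (i < k)%N -> v i != 0) ->
  (forall i, (i < k.+1)%N -> s i != 0) ->
  (\sum_(i < k) (\prod_(j < k) rho1 s v i j) * (1 - s k / v i))
  * ((s k)^-1 * \prod_(i < k) (v i / s i))
  = \sum_(i < k) ((v i)^-1 - (s i)^-1) + (s k)^-1 * (\prod_(i < k) (v i / s i) - 1).
Proof.
move=> vI v0 s0.
have uI : distinct k (fun i => (v i)^-1) by move=> i j ik jk /invr_inj; apply: vI.
have u0 i : (i < k)%N -> (v i)^-1 != 0 by move=> ik; rewrite invr_eq0 v0.
have := divdiff_sub0 (fun i => (s i)^-1) uI u0.
have -> : \prod_(j < k.+1) - (s j)^-1 / \prod_(j < k) - (v j)^-1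
        = - ((s k)^-1 * \prod_(i < k) (v i / s i)).
  rewrite big_ord_recr /= mulrAC -prodf_div mulrN mulrC; congr (- (_ * _)).
  by apply: eq_bigr => i _; rewrite invrN mulrNN invrK mulrC.
rewrite [in X in _ -> X]sumrB big_ord_recr /= => /(canRL (addrK _)).
rewrite opprK => sumE; transitivity (\sum_(i < k) (v i)^-1 -
   (\sum_(i < k) (s i)^-1 + (s k)^-1) + (s k)^-1 * \prod_(i < k) (v i / s i)).
  rewrite -sumE mulr_suml; apply: eq_bigr => i _; rewrite big_ord_recr /=.
  rewrite (bigD1 i) //= [\prod_(j < k) (v j / s j)](bigD1 i) //=.
  rewrite [in RHS](bigD1 i) //= {1}/rho1 eqxx.
  have e (j : 'I_k) : j != i -> v i - v j != 0.
    by move=> ji; rewrite subr_eq0; apply: contraNneq ji => vij; apply/eqP/esym/val_inj/(vI _ _ (ltn_ord i) (ltn_ord j)).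
  have sk (j : 'I_k) : s j != 0 by rewrite s0 // ltnS ltnW.
  transitivity ((1 - s i / v i) * (1 - s k / v i) * ((s k)^-1 * (v i / s i))
    * \prod_(j < k | j != i) (rho1 s v i j * (v j / s j))).
    by rewrite [in RHS]big_split /=; ring.
  transitivity (((v i)^-1 - (s i)^-1) * ((v i)^-1 - (s k)^-1) / (v i)^-1
    * \prod_(j < k | j != i) (((v i)^-1 - (s j)^-1) / ((v i)^-1 - (v j)^-1))).
    congr (_ * _); first by field; rewrite v0 // oner_neq0 s0 ?sk.
    apply: eq_bigr => j ji; rewrite /rho1 ifN 1?eq_sym //.
    have := e _ ji; rewrite -oppr_eq0 opprB => e'.
    by field; rewrite mulN1r !v0 // sk e' e.
  rewrite prodf_div [RHS]mulrC invfM; ring.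
by ring.
Qed.

(** The product of [rho1] and [rhoB] is a quotient of differences of values of z + 1/z, because v +
    1/v - w - 1/w = (v - w)(v w - 1) / (v w). The condition on the products v_i v_j makes these
    nodes distinct. *)
Lemma sum_rhoB k (s v : nat -> F) :
  distinct k v -> (forall i, (i < k)%N -> v i != 0) ->
  (forall i, (i < k)%N -> s i != 0) ->
  (forall i j, (i < k)%N -> (j < k)%N -> v i * v j != 1) ->
  \sum_(i < k) v i * \prod_(j < k) (rho1 s v i j * rhoB s v i j)
  = \sum_(i < k) (v i + (v i)^-1 - (s i + (s i)^-1)).
Proof.
move=> vI v0 s0 vv.
have e (i j : 'I_k) : j != i -> v i - v j != 0.
  by move=> ji; rewrite subr_eq0; apply: contraNneq ji => vij; apply/eqP/esym/val_inj/(vI _ _ (ltn_ord i) (ltn_ord j)).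
have e2 (i j : 'I_k) : v i * v j - 1 != 0 by rewrite subr_eq0 vv.
have wB_ (i j : 'I_k) : v i + (v i)^-1 - (v j + (v j)^-1)
                     = (v i - v j) * (v i * v j - 1) / (v i * v j).
  by field; rewrite !v0.
have wI : injective (fun i : 'I_k => v i + (v i)^-1).
  move=> i j wij; apply/eqP; rewrite eq_sym; case: eqVneq => // ji.
  have := wB_ i j; rewrite wij subrr => /esym/eqP.
  by rewrite !mulf_eq0 invr_eq0 mulf_eq0 (negbTE (e i j ji)) (negbTE (e2 i j)) !(negbTE (v0 _ _)).
rewrite sumrB -(divdiff_sub (fun i : 'I_k => s i + (s i)^-1) wI).
apply: eq_bigr => i _; rewrite (bigD1 i) //= [X in _ = X / _](bigD1 i) //=.
rewrite -[RHS]mulrA -prodf_div [LHS]mulrA; congr (_ * _).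
  by rewrite /rho1 /rhoB eqxx; field; rewrite v0 ?s0.
apply: eq_bigr => j ji; rewrite /= /rho1 /rhoB.
have -> : (i : nat) == j = false by rewrite eq_sym; apply/negbTE.
rewrite wB_.
by field; rewrite !v0 // s0 // e // e2.
Qed.

Lemma prod_rho2 k (s v : nat -> F) (i : 'I_k) :
  distinct k.+1 s -> (forall i, (i < k)%N -> v i != 0) ->
  (forall i, (i < k.+1)%N -> s i != 0) ->
  (\prod_(j < k) ((s i)^-1 - (v j)^-1))
    / \prod_(j < k.+1 | j != i :> nat) ((s i)^-1 - (s j)^-1)
  = (\prod_(j < k) rho2 s v i j) / (1 - s i / s k).
Proof.
move=> sI v0 s0; have sk (j : 'I_k) : s j != 0 by rewrite s0 // ltnS ltnW.
have e (j : nat) : (j < k.+1)%N -> j != i -> s i - s j != 0.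
  move=> jk ji; rewrite subr_eq0; apply: contraNneq ji => sij; apply/eqP/esym.
  by apply: sI => //; rewrite ltnS ltnW.
rewrite (prod_ord_recr_neq i (fun j => (s i)^-1 - (s j)^-1)).
rewrite [in LHS](bigD1 i) //= [in RHS](bigD1 i) //= {1}/rho2 eqxx.
transitivity (((s i)^-1 - (v i)^-1) / ((s i)^-1 - (s k)^-1) *
  \prod_(j < k | j != i) (((s i)^-1 - (v j)^-1) / ((s i)^-1 - (s j)^-1))).
  by rewrite prodf_div invfM; ring.
rewrite [RHS]mulrAC; congr (_ * _).
  have := e k (ltnSn k); rewrite gtn_eqF // => /(_ isT) ek.
  have := ek; rewrite -oppr_eq0 opprB => ek'.
  by field; rewrite v0 // !s0 // ?ek ?ek' // ltnS ltnW.
apply: eq_bigr => j ji; rewrite /rho2 ifN 1?eq_sym //.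
have ej := e j (ltnW (ltn_ord j) : (j < k.+1)%N) ji.
have := ej; rewrite -oppr_eq0 opprB => ej'.
by field; rewrite v0 // !sk ?ej ?ej'.
Qed.

Lemma prod_rho2_last k (s v : nat -> F) :
  distinct k.+1 s -> (forall i, (i < k)%N -> v i != 0) ->
  (forall i, (i < k.+1)%N -> s i != 0) ->
  (\prod_(j < k) ((s k)^-1 - (v j)^-1))
    / \prod_(j < k.+1 | j != k :> nat) ((s k)^-1 - (s j)^-1)
  = \prod_(j < k) ((1 - s k / v j) / (1 - s k / s j)).
Proof.
move=> sI v0 s0; have sk (j : 'I_k) : s j != 0 by rewrite s0 // ltnS ltnW.
rewrite (prod_ord_recr_last k (fun j => (s k)^-1 - (s j)^-1)) -prodf_div.
apply: eq_bigr => j _.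
have e : s k - s j != 0.
  rewrite subr_eq0; apply/eqP => skj; have := sI k j (ltnSn k) _ skj.
  by rewrite ltnS ltnW // => /(_ isT) kj; have := ltn_ord j; rewrite -kj ltnn.
have := e; rewrite -oppr_eq0 opprB => e'.
by field; rewrite v0 // !s0 // ?e ?e' // ltnS ltnW.
Qed.

(** The roles are exchanged: the 1 / s_i with i <= k are the nodes and the 1 / v_j with j < k the
    roots, so the sum is the leading coefficient of a monic polynomial of degree k. *)
Lemma sum_rho2 k (s v : nat -> F) :
  distinct k.+1 s -> (forall i, (i < k)%N -> v i != 0) ->
  (forall i, (i < k.+1)%N -> s i != 0) ->
  \sum_(i < k) (\prod_(j < k) rho2 s v i j) / (1 - s i / s k)
  + \prod_(j < k) ((1 - s k / v j) / (1 - s k / s j)) = 1.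
Proof.
move=> sI v0 s0.
have tI : injective (fun i : 'I_k.+1 => (s i)^-1).
  by move=> i j /invr_inj sij; apply/val_inj/(sI _ _ (ltn_ord i) (ltn_ord j)).
rewrite -[RHS](divdiff_lead (fun j : 'I_k => (v j)^-1) tI) big_ord_recr /=.
rewrite -(prod_rho2_last sI v0 s0); congr (_ + _).
by apply: eq_bigr => i _; rewrite -(prod_rho2 i sI v0 s0).
Qed.

(** The weight s_i is the inverse of the node 1 / s_i, so it amounts to one more node, 0. The degree
    is then too small, the full sum vanishes, and the right-hand side is minus the summand of the
    node 0. *)
Lemma sum_rho2_weighted k (s v : nat -> F) :
  distinct k.+1 s -> (forall i, (i < k)%N -> v i != 0) ->
  (forall i, (i < k.+1)%N -> s i != 0) ->
  \sum_(i < k) s i * ((\prod_(j < k) rho2 s v i j) / (1 - s i / s k))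
  + s k * \prod_(j < k) ((1 - s k / v j) / (1 - s k / s j))
  = s k * \prod_(j < k) (s j / v j).
Proof.
move=> sI v0 s0.
have tI : distinct k.+1 (fun i => (s i)^-1) by move=> i j ik jk /invr_inj; apply: sI.
have t0 i : (i < k.+1)%N -> (s i)^-1 != 0 by move=> ik; rewrite invr_eq0 s0.
have := divdiff_low0 (fun j => (v j)^-1) tI t0.
have -> : \prod_(j < k) - (v j)^-1 / \prod_(j < k.+1) - (s j)^-1
   = - (s k * \prod_(j < k) (s j / v j)).
  rewrite big_ord_recr /= invfM mulrA -prodf_div invrN invrK mulrN mulrC.
  by congr (- (_ * _)); apply: eq_bigr => j _; rewrite invrN mulrNN invrK mulrC.
move/eqP; rewrite subr_eq0 => /eqP <-; rewrite big_ord_recr /=.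
rewrite -(prod_rho2_last sI v0 s0); congr (_ + _).
  apply: eq_bigr => i _; rewrite -(prod_rho2 i sI v0 s0) invfM invrK.
  by rewrite [RHS]mulrA mulrC.
by rewrite invfM invrK [RHS]mulrA mulrC.
Qed.

(** * Compositions and their reindexing *)

Fixpoint comps k d : seq (seq nat) :=
  if k is k'.+1 then [seq x :: t | x <- iota 0 d.+1, t <- comps k' (d - x)%N]
  else if d is 0 then [:: [::]] else [::].

Lemma compsS k d :
  comps k.+1 d = [seq x :: t | x <- iota 0 d.+1, t <- comps k (d - x)%N].
Proof. by []. Qed.

Lemma mem_comps k d t : (t \in comps k d) = (size t == k) && (sumn t == d).
Proof.
elim: k d t => [|k IHk] d t; first by case: d t => [|d] [|x t].
rewrite compsS.
apply/allpairsPdep/andP => [[x [u [xd ud ->]]]|[]].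
  move: ud; rewrite IHk => /andP [/eqP <- /eqP su] /=; split=> //.
  by rewrite su subnKC //; move: xd; rewrite mem_iota add0n ltnS.
case: t => // x u /= /eqP [su] /eqP xu; exists x, u; split=> //.
  by rewrite -[0%N :: _]/(iota 0 d.+1) mem_iota add0n ltnS -xu leq_addr.
by rewrite IHk su eqxx -xu addKn eqxx.
Qed.

Lemma comps_uniq k d : uniq (comps k d).
Proof.
elim: k d => [|k IHk] d; first by case: d.
rewrite compsS.
apply: allpairs_uniq_dep => [|x _|[x t] [y u] _ _ /= [-> ->]] //.
exact: iota_uniq.
Qed.

(** A negative exponent admits no column; the empty list gives the coefficient 0 without a case
    distinction. *)
Definition compz k (z : int) := if z is Posz d then comps k d else [::].

Lemma compzP k z t :
  reflect (size t = k /\ (sumn t)%:Z = z) (t \in compz k z).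
Proof.
case: z => d /=; last by apply: (iffP idP) => // -[].
rewrite mem_comps; apply: (iffP andP) => [[/eqP -> /eqP ->]|[-> [->]]] //.
Qed.

Lemma compz_uniq k z : uniq (compz k z).
Proof. by case: z => // d; apply: comps_uniq. Qed.

Lemma sumn_incr_nth t i : sumn (incr_nth t i) = (sumn t).+1.
Proof.
elim: t i => [|x t IHt] [|i] //=; last by rewrite IHt addnS.
by elim: i => //= i ->.
Qed.

(** Adding e_i is a bijection onto the compositions of z + 1 with positive i-th part; the hypothesis
    on [h] removes all the others. *)
Lemma sum_comps_incr1 k z i (h : seq nat -> F) : (i < k)%N ->
  (forall t, nth 0%N t i = 0%N -> h t = 0) ->
  \sum_(t <- compz k z) h (incr_nth t i) = \sum_(t <- compz k (z + 1)) h t.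
Proof.
move=> ik h0; rewrite -(big_map (fun t => incr_nth t i) predT h).
rewrite [RHS](bigID (fun t => 0 < nth 0 t i)%N) /= [X in _ = _ + X]big1 ?addr0; last first.
  by move=> t; rewrite -eqn0Ngt => /eqP; apply: h0.
rewrite -[RHS]big_filter; apply/perm_big/uniq_perm.
- rewrite map_inj_in_uniq ?compz_uniq // => t u /compzP [st _] /compzP [su _] tu.
  apply: (@eq_from_nth _ 0%N) => [|j _]; first by rewrite st su.
  by have := congr1 (fun w => nth 0%N w j) tu; rewrite !nth_incr_nth => /addnI.
- by rewrite filter_uniq ?compz_uniq.
move=> t; rewrite mem_filter; apply/mapP/andP => [[u /compzP [su zu] ->]|].
  rewrite nth_incr_nth eqxx; split=> //; apply/compzP.
  by rewrite size_incr_nth su ik sumn_incr_nth -addn1 PoszD zu.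
move=> [ti /compzP [st zt]]; pose u := set_nth 0%N t i (nth 0%N t i).-1.
have tu : t = incr_nth u i.
  apply: (@eq_from_nth _ 0%N) => [|j _].
    rewrite size_incr_nth size_set_nth st (maxn_idPr ik) ik //.
  rewrite nth_incr_nth nth_set_nth /= [j == i]eq_sym.
  by case: eqVneq => [<-|_]; rewrite ?add1n ?prednK.
exists u => //; apply/compzP; split.
  by rewrite size_set_nth st (maxn_idPr ik).
by move: zt; rewrite tu sumn_incr_nth -addn1 PoszD => /addIr.
Qed.

Lemma sum_comps_incr k z (h : nat -> seq nat -> F) :
  (forall i t, (i < k)%N -> nth 0%N t i = 0%N -> h i t = 0) ->
  \sum_(t <- compz k z) \sum_(i < k) h i (incr_nth t i)
  = \sum_(t <- compz k (z + 1)) \sum_(i < k) h i t.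
Proof.
move=> h0; rewrite exchange_big [RHS]exchange_big; apply: eq_bigr => i _ /=.
by apply: sum_comps_incr1 => // t; apply: h0.
Qed.

Definition nt (t : seq nat) i := nth 0%N t i.

Lemma nt_incr t i : nt (incr_nth t i) = incr (nt t) i.
Proof. by apply: functional_extensionality => j; rewrite /nt nth_incr_nth. Qed.

(** The coefficient of x^a in x^{-t} g is the coefficient of x^{a + t} in g. *)
Definition addv (a : nat -> int) (t : nat -> nat) i : int := a i + (t i)%:Z.
Definition transfer (a : nat -> int) (i j : nat) : int := a j + (i == j)%:Z - (i.+1 == j)%:Z.

Lemma addv_unitv a t i : addv (addv a (unitv i)) t = addv a (incr t i).
Proof.
apply: functional_extensionality => j.
by rewrite /addv /unitv /incr PoszD addrA.
Qed.

Lemma addvC a t u : addv (addv a t) u = addv (addv a u) t.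
Proof. by apply: functional_extensionality => j; rewrite /addv addrAC. Qed.

Lemma addv_transfer a t i : addv (transfer a i) t = transfer (addv a t) i.
Proof. by apply: functional_extensionality => j; rewrite /addv /transfer; ring. Qed.

(* Coefficient of x^a in the A_{k-1} q-Toda function in k variables. *)
Fixpoint fA k (s : nat -> F) (a : nat -> int) : F :=
  if k is k'.+1 then
    \sum_(t <- compz k' (a k')) eA k' s (nt t) * fA k' (qshift s (nt t)) (addv a (nt t))
  else 1.

Lemma fA_ext k s s' a a' :
  (forall i, (i < k)%N -> s i = s' i) -> (forall i, (i < k)%N -> a i = a' i) ->
  fA k s a = fA k s' a'.
Proof.
elim: k s s' a a' => //= k IHk s s' a a' ss' aa'; rewrite aa' //.
apply: eq_bigr => t _; congr (_ * _).
  rewrite /eA (@WA_ext k s s') => [|i ik]; last by rewrite ss' // ltnS ltnW.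
  congr (_ * _); apply: eq_bigr => i _.
  by rewrite !ss' // ltnS ltnW.
by apply: IHk => i ik; rewrite /qshift /addv ?ss' ?aa' // ltnS ltnW.
Qed.

(** Only the product of the q^{t_j} is left. This is how the summand of the node 0 becomes the
    action of the q-shift on the last variable. *)
Lemma prod_ratio_qshift k s z t : generic k s -> t \in compz k z ->
  \prod_(j < k) (s j / qshift s (nt t) j) = q ^ z.
Proof.
move=> [s0 _] /compzP [st <-]; rewrite -exprnP sumnE (big_nth 0%N) st big_mkord.
rewrite expr_sum; apply: eq_bigr => j _; rewrite /qshift -/(nt t j).
by field; rewrite s0 ?expf_neq0.
Qed.

Lemma prod_ratio_qshiftV k s z t : generic k s -> t \in compz k z ->
  \prod_(j < k) (qshift s (nt t) j / s j) = q ^ (- z).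
Proof.
move=> gs tz; rewrite -invr_expz -(prod_ratio_qshift gs tz) -prodfV.
by apply: eq_bigr => j _; rewrite invf_div.
Qed.

(** An index with [t i = 0] is unshifted. This zero of the diagonal factor supplies the vanishing
    that the reindexing by e_i requires. *)
Lemma rho1_id0 k s t i : generic k s -> (i < k)%N -> t i = 0%N ->
  1 - s i / qshift s t i = 0.
Proof. by move=> [s0 _] ik ti; rewrite /qshift ti expr0 invr1 mul1r divff ?subrr ?s0. Qed.

Lemma pieri_last k s : pieri k.+1 s k = 1.
Proof.
by apply: big1 => j _; rewrite /pieri1 ltnNge -ltnS ltn_ord.
Qed.

(** * Pieri rules *)

(** Common core of the two rules, with c = 1 or c = s. Branching f(x|q^{-e_i} s) along t produces
    the parameters q^{-(t + e_i)} s; after regrouping by t + e_i each function in k variables is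
    multiplied by the single sum [L]. *)
Lemma pieri_weighted k s a (c : nat -> F) (L : (nat -> nat) -> F) :
  generic k.+1 s ->
  (forall t, \sum_(i < k) c i * ((\prod_(j < k) rho2 s (qshift s t) i j) / (1 - s i / s k))
    + c k * \prod_(j < k) ((1 - s k / qshift s t j) / (1 - s k / s j)) = L t) ->
  \sum_(i < k.+1) c i * (pieri k.+1 s i * fA k.+1 (qshift s (unitv i)) (addv a (unitv i)))
  = \sum_(t <- compz k (a k + 1))
      L (nt t) * (eA k s (nt t) * fA k (qshift s (nt t)) (addv a (nt t))).
Proof.
move=> gs LE; have gs' := generic_leq (leqnSn k) gs.
rewrite big_ord_recr /= pieri_last mul1r.
(* The term i = k raises the last exponent, so its columns already have the sum that the others
   reach after reindexing. *)
have -> : addv a (unitv k) k = a k + 1 by rewrite /addv /unitv eqxx.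
pose R (i : nat) t := (\prod_(j < k) rho2 s (qshift s t) i j) / (1 - s i / s k).
pose h i t := c i * (eA k s (nt t) * R i (nt t)) * fA k (qshift s (nt t)) (addv a (nt t)).
have -> : \sum_(i < k) c i * (pieri k.+1 s i *
    \sum_(t <- compz k (addv a (unitv i) k))
       eA k (qshift s (unitv i)) (nt t) *
       fA k (qshift (qshift s (unitv i)) (nt t)) (addv (addv a (unitv i)) (nt t)))
  = \sum_(t <- compz k (a k)) \sum_(i < k) h i (incr_nth t i).
  rewrite exchange_big; apply: eq_bigr => i _.
  have -> : addv a (unitv i) k = a k by rewrite /addv /unitv ltn_eqF ?addr0.
  rewrite !mulr_sumr.
  apply: eq_bigr => t _; rewrite qshift_unitv addv_unitv /h nt_incr /R -eA_unitv //.
  by ring.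
rewrite sum_comps_incr => [|i t ik ti]; last first.
  rewrite /h /R (bigD1 (Ordinal ik)) //= {1}/rho2 eqxx (rho1_id0 gs') //.
  by rewrite !mul0r !mulr0 mul0r.
rewrite mulr_sumr -big_split; apply: eq_bigr => t _ /=; rewrite -LE mulrDl.
congr (_ + _).
  by rewrite mulr_suml; apply: eq_bigr => i _; rewrite /h /R; ring.
rewrite eA_unitv_last // (@fA_ext k _ (qshift s (nt t)) _ (addv a (nt t))) => [|i ik|i ik].
- by ring.
- by rewrite {1}/qshift qshift_unitv_neq ?ltn_eqF.
- by rewrite addv_unitv /addv incr_neq ?ltn_eqF.
Qed.

Lemma fA_unitv_last k s a :
  fA k.+1 s (addv a (unitv k))
  = \sum_(t <- compz k (a k + 1)) eA k s (nt t) * fA k (qshift s (nt t)) (addv a (nt t)).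
Proof.
have -> : fA k.+1 s (addv a (unitv k)) = \sum_(t <- compz k (a k + 1))
    eA k s (nt t) * fA k (qshift s (nt t)) (addv (addv a (unitv k)) (nt t)).
  by rewrite /= /addv /unitv eqxx.
apply: eq_bigr => t _; congr (_ * _).
by apply: fA_ext => // i ik; rewrite addv_unitv /addv incr_neq ?ltn_eqF.
Qed.

Lemma fA_pieri k s a : generic k.+1 s ->
  fA k.+1 s (addv a (unitv k))
  = \sum_(i < k.+1) pieri k.+1 s i * fA k.+1 (qshift s (unitv i)) (addv a (unitv i)).
Proof.
move=> gs; have gs' := generic_leq (leqnSn k) gs; have [s0 _] := gs.
transitivity (\sum_(i < k.+1) 1 *
  (pieri k.+1 s i * fA k.+1 (qshift s (unitv i)) (addv a (unitv i)))); last first.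
  by apply: eq_bigr => i _; rewrite mul1r.
rewrite (@pieri_weighted k s a (fun=> 1) (fun=> 1) gs) => [|t].
  by rewrite fA_unitv_last; apply: eq_bigr => t _; rewrite mul1r.
rewrite mul1r -[RHS](@sum_rho2 k s (qshift s t)) //.
- by under eq_bigr do rewrite mul1r.
- exact: generic_distinct.
- by have [] := generic_qshift t gs'.
Qed.

Lemma fA_pieri_weighted k s a : generic k.+1 s ->
  s k * q ^ (a k + 1) * fA k.+1 s (addv a (unitv k))
  = \sum_(i < k.+1)
      s i * (pieri k.+1 s i * fA k.+1 (qshift s (unitv i)) (addv a (unitv i))).
Proof.
move=> gs; have gs' := generic_leq (leqnSn k) gs; have [s0 _] := gs.
rewrite (@pieri_weighted k s a s
  (fun t => s k * \prod_(j < k) (s j / qshift s t j)) gs) => [|t].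
  rewrite fA_unitv_last mulr_sumr; apply: eq_big_seq => t tz.
  by rewrite (prod_ratio_qshift gs' tz).
apply: sum_rho2_weighted => //; first exact: generic_distinct.
by have [] := generic_qshift t gs'.
Qed.

(** * Eigenvalue equations *)

(** Once a Pieri rule has been applied inside every branch, this collects the boundary term by its
    new index t + e_i. It serves both [eA] and [eB]; the factor q^{-1} undoes the [q] of the weight
    recursion. *)
Lemma lower_sum K s z (E Phi : (nat -> nat) -> F) (R c : nat -> (nat -> nat) -> F) :
  (forall t (i : 'I_K), E t * pieri K (qshift s t) i * q = E (incr t i) * R i (incr t i)) ->
  (forall i t, (i < K)%N -> t i = 0%N -> R i t = 0) ->
  \sum_(t <- compz K z) E (nt t) * (\sum_(i < K) c i (incr (nt t) i)
      * (pieri K (qshift s (nt t)) i * Phi (incr (nt t) i)))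
  = \sum_(t <- compz K (z + 1))
      E (nt t) * (q^-1 * \sum_(i < K) c i (nt t) * R i (nt t)) * Phi (nt t).
Proof.
move=> EE R0.
pose h i t := c i (nt t) * (q^-1 * (E (nt t) * R i (nt t))) * Phi (nt t).
transitivity (\sum_(t <- compz K z) \sum_(i < K) h i (incr_nth t i)).
  apply: eq_bigr => t _; rewrite mulr_sumr; apply: eq_bigr => i _.
  by rewrite /h nt_incr -EE; field; rewrite q0.
rewrite sum_comps_incr => [|i t ik ti]; last by rewrite /h R0 // !mulr0 mul0r.
apply: eq_bigr => t _; rewrite mulrA mulr_sumr mulr_suml.
by apply: eq_bigr => i _; rewrite /h; ring.
Qed.

(* Coefficient of x^a in D f, for f given by its coefficients: the A-type
   operators sum_i s_i (1 - x_{i+1}/x_i) T_i and sum_i s_i^{-1} (1 - x_i/x_{i-1}) T_i^{-1},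
   without the boundary ratios; [transfer a i] is the exponent a + e_i - e_{i+1}. *)
Definition DA k (s : nat -> F) (f : (nat -> int) -> F) (a : nat -> int) :=
  \sum_(i < k) s i * q ^ (a i) * f a
  - \sum_(i < k.-1) s i * q ^ (a i + 1) * f (transfer a i).

Definition DAbar k (s : nat -> F) (f : (nat -> int) -> F) (a : nat -> int) :=
  \sum_(i < k) (s i)^-1 * q ^ (- a i) * f a
  - \sum_(i < k.-1) (s i.+1)^-1 * q ^ (1 - a i.+1) * f (transfer a i).

(** On x^{-t} g the operator s_i T_i acts as q^{-t_i} s_i T_i does on g: the shift of the parameter
    cancels the shift of the exponent. *)
Lemma qshift_addv s t a i z :
  qshift s t i * q ^ (addv a t i + z) = s i * q ^ (a i + z).
Proof.
rewrite /qshift /addv !expfzDr // -exprnP; field.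
by rewrite expf_neq0.
Qed.

Lemma qshift_addvV s t a i z :
  (qshift s t i)^-1 * q ^ (z - addv a t i) = (s i)^-1 * q ^ (z - a i).
Proof.
rewrite /qshift /addv opprD !expfzDr // invfM invrK -[q ^ (- (t i)%:Z)]invr_expz -exprnP.
have Q0 : q ^+ t i != 0 by rewrite expf_neq0.
by move: (s i)^-1 (q ^+ t i) Q0 => u Q Q0; field.
Qed.

(** A transfer between two of the first [K] variables leaves the sum of t unchanged, so the same
    list [L] indexes all terms and the operator passes inside the branching sum. *)
Lemma DA_branch K s (L : seq (seq nat)) (E : seq nat -> F) f
    (Psi : seq nat -> (nat -> int) -> F) a :
  f a = \sum_(t <- L) E t * Psi t (addv a (nt t)) ->
  (forall i, (i < K.-1)%N -> f (transfer a i)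
     = \sum_(t <- L) E t * Psi t (addv (transfer a i) (nt t))) ->
  DA K s f a = \sum_(t <- L) E t * DA K (qshift s (nt t)) (Psi t) (addv a (nt t)).
Proof.
move=> fa fm; rewrite /DA; under [RHS]eq_bigr do rewrite mulrBr !mulr_sumr.
rewrite [RHS]sumrB; congr (_ - _); rewrite [RHS]exchange_big; apply: eq_bigr => i _ /=.
  rewrite fa mulr_sumr; apply: eq_bigr => t _.
  by have := qshift_addv s (nt t) a i 0; rewrite !addr0 => ->; ring.
rewrite fm // mulr_sumr; apply: eq_bigr => t _.
by rewrite qshift_addv addv_transfer; ring.
Qed.

Lemma DAbar_branch K s (L : seq (seq nat)) (E : seq nat -> F) f
    (Psi : seq nat -> (nat -> int) -> F) a :
  f a = \sum_(t <- L) E t * Psi t (addv a (nt t)) ->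
  (forall i, (i < K.-1)%N -> f (transfer a i)
     = \sum_(t <- L) E t * Psi t (addv (transfer a i) (nt t))) ->
  DAbar K s f a = \sum_(t <- L) E t * DAbar K (qshift s (nt t)) (Psi t) (addv a (nt t)).
Proof.
move=> fa fm; rewrite /DAbar; under [RHS]eq_bigr do rewrite mulrBr !mulr_sumr.
rewrite [RHS]sumrB; congr (_ - _); rewrite [RHS]exchange_big; apply: eq_bigr => i _ /=.
  rewrite fa mulr_sumr; apply: eq_bigr => t _.
  by have := qshift_addvV s (nt t) a i 0; rewrite !sub0r => ->; ring.
rewrite fm // mulr_sumr; apply: eq_bigr => t _.
by rewrite qshift_addvV addv_transfer; ring.
Qed.

Lemma fA_S k s a : fA k.+1 s a =
  \sum_(t <- compz k (a k)) eA k s (nt t) * fA k (qshift s (nt t)) (addv a (nt t)).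
Proof. by []. Qed.

Lemma qshift_addv_unitv k s a t i :
  fA k (qshift (qshift s t) (unitv i)) (addv (addv a t) (unitv i))
  = fA k (qshift s (incr t i)) (addv a (incr t i)).
Proof.
rewrite addvC addv_unitv -qshift_unitv; congr (fA k _ _).
by apply: functional_extensionality => j; rewrite /qshift mulrCA.
Qed.

Lemma DA_recr k s f a :
  DA k.+2 s f a = DA k.+1 s f a + s k.+1 * q ^ (a k.+1) * f a
                  - s k * q ^ (a k + 1) * f (transfer a k).
Proof. by rewrite /DA big_ord_recr /= [X in _ - X]big_ord_recr /=; ring. Qed.

Lemma DAbar_recr k s f a :
  DAbar k.+2 s f a = DAbar k.+1 s f a + (s k.+1)^-1 * q ^ (- a k.+1) * f a
                  - (s k.+1)^-1 * q ^ (1 - a k.+1) * f (transfer a k).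
Proof. by rewrite /DAbar big_ord_recr /= [X in _ - X]big_ord_recr /=; ring. Qed.

(** One unit leaves the newest variable, which lowers the column sum by one, and the remaining
    factor is x_k^{-1} times the smaller function: the place where a Pieri rule applies. *)
Lemma fA_transfer k s a :
  fA k.+2 s (transfer a k) = \sum_(t <- compz k.+1 (a k.+1 - 1))
    eA k.+1 s (nt t) * fA k.+1 (qshift s (nt t)) (addv (addv a (nt t)) (unitv k)).
Proof.
have -> : a k.+1 - 1 = transfer a k k.+1 by rewrite /transfer eqxx ltn_eqF // addr0.
rewrite fA_S; apply: eq_bigr => t _; congr (_ * _); apply: fA_ext => // i.
rewrite ltnS => ik; rewrite /addv /transfer /unitv.
have -> : k.+1 == i = false by rewrite gtn_eqF.
by rewrite subr0; ring.
Qed.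

Lemma fA_transfer_lower k s a i : (i < k)%N ->
  fA k.+2 s (transfer a i) = \sum_(t <- compz k.+1 (a k.+1))
    eA k.+1 s (nt t) * fA k.+1 (qshift s (nt t)) (addv (transfer a i) (nt t)).
Proof.
move=> ik; have -> // : a k.+1 = transfer a i k.+1.
by rewrite /transfer !ltn_eqF ?addr0 ?subr0 // ltnS ltnW.
Qed.

Lemma rho1_extra0 k s (t : nat -> nat) i c : generic k s -> (i < k)%N -> t i = 0%N ->
  (\prod_(j < k) rho1 s (qshift s t) i j) * c = 0.
Proof.
move=> gs ik ti; rewrite (bigD1 (Ordinal ik)) //= {1}/rho1 eqxx (rho1_id0 gs) //.
by rewrite !mul0r.
Qed.

Arguments fA : simpl never.

(** By induction on the number of variables. In the branch t the old variables give the sum of the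
    v_i, the new one gives s_K q^{a_K}, and the boundary term subtracts the sum evaluated by
    [sum_rho1]; what is left is the sum of the s_i. *)
Lemma DA_fA k s a : generic k.+1 s ->
  DA k.+1 s (fA k.+1 s) a = (\sum_(i < k.+1) s i) * fA k.+1 s a.
Proof.
elim: k s a => [|k IHk] s a gs.
  rewrite /DA big_ord0 subr0 !big_ord1 fA_S; case: (a 0%N) => [[|d]|d] /=.
  - by rewrite expr0z mulr1.
  - by rewrite big_nil !mulr0.
  - by rewrite big_nil !mulr0.
have gs' := generic_leq (leqnSn _) gs.
set K := k.+1 in IHk gs gs' *; pose Phi t := fA K (qshift s t) (addv a t).
rewrite DA_recr -/K (@DA_branch K s (compz K (a K)) (fun t => eA K s (nt t)) _
  (fun t => fA K (qshift s (nt t)))) //; last by move=> i ik; rewrite fA_transfer_lower.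
rewrite fA_transfer -/K mulr_sumr.
pose R (i : nat) t := (\prod_(j < K) rho1 s (qshift s t) i j) * (1 - s K / qshift s t i).
(* The weight v_i of the rule at t is written as [q] times its value at t + e_i, so that it depends
   on the new index only. *)
have -> : \sum_(t <- compz K (a K - 1)) s k * q ^ (a k + 1) *
    (eA K s (nt t) * fA K (qshift s (nt t)) (addv (addv a (nt t)) (unitv k)))
  = \sum_(t <- compz K (a K - 1)) eA K s (nt t) *
    \sum_(i < K) (q * qshift s (incr (nt t) i) i)
      * (pieri K (qshift s (nt t)) i * Phi (incr (nt t) i)).
  apply: eq_bigr => t _; rewrite mulrCA -(qshift_addv s (nt t)) fA_pieri_weighted.
    congr (_ * _); apply: eq_bigr => i _.
    by rewrite qshift_incr_id mulVKf // qshift_addv_unitv.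
  exact: generic_qshift.
rewrite (@lower_sum K s _ (eA K s) Phi R (fun i t => q * qshift s t i)); first last.
- by move=> i t iK ti; apply: rho1_extra0.
- by move=> t i; apply: eA_incr.
rewrite subrK fA_S !mulr_sumr -big_split -sumrB; apply: eq_big_seq => t tz /=.
have gt := generic_qshift (nt t) gs'.
rewrite IHk // [X in q^-1 * X](_ : _ = q * \sum_(i < K) qshift s (nt t) i * R i (nt t)).
  rewrite mulKf // sum_rho1; [|exact: generic_distinct|by case: gt].
  by rewrite (prod_ratio_qshift gs' tz) sumrB [in RHS]big_ord_recr /= /Phi; ring.
by rewrite mulr_sumr; apply: eq_bigr => i _; rewrite [RHS]mulrA.
Qed.

(** In the boundary term the inverse shift acts on the new variable, whose exponent is the same in
    all branches. The power of [q] therefore factors out and the plain Pieri rule suffices. *)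
Lemma DAbar_fA k s a : generic k.+1 s ->
  DAbar k.+1 s (fA k.+1 s) a = (\sum_(i < k.+1) (s i)^-1) * fA k.+1 s a.
Proof.
elim: k s a => [|k IHk] s a gs.
  rewrite /DAbar big_ord0 subr0 !big_ord1 fA_S; case: (a 0%N) => [[|d]|d] /=.
  - by rewrite oppr0 expr0z mulr1.
  - by rewrite big_nil !mulr0.
  - by rewrite big_nil !mulr0.
have gs' := generic_leq (leqnSn _) gs; have [s0 _] := gs.
set K := k.+1 in IHk gs gs' s0 *; pose Phi t := fA K (qshift s t) (addv a t).
rewrite DAbar_recr -/K (@DAbar_branch K s (compz K (a K)) (fun t => eA K s (nt t)) _
  (fun t => fA K (qshift s (nt t)))) //; last by move=> i ik; rewrite fA_transfer_lower.
rewrite fA_transfer -/K.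
pose R (i : nat) t := (\prod_(j < K) rho1 s (qshift s t) i j) * (1 - s K / qshift s t i).
have -> : \sum_(t <- compz K (a K - 1))
    (eA K s (nt t) * fA K (qshift s (nt t)) (addv (addv a (nt t)) (unitv k)))
  = \sum_(t <- compz K (a K - 1)) eA K s (nt t) *
    \sum_(i < K) 1 * (pieri K (qshift s (nt t)) i * Phi (incr (nt t) i)).
  apply: eq_bigr => t _; rewrite fA_pieri; last exact: generic_qshift.
  by congr (_ * _); apply: eq_bigr => i _; rewrite qshift_addv_unitv mul1r.
rewrite (@lower_sum K s _ (eA K s) Phi R (fun _ _ => 1)); first last.
- by move=> i t iK ti; apply: rho1_extra0.
- by move=> t i; apply: eA_incr.
rewrite subrK fA_S !mulr_sumr -big_split -sumrB; apply: eq_big_seq => t tz /=.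
have gt := generic_qshift (nt t) gs'.
have sumE := @sum_rho1_inv K s (qshift s (nt t)) (generic_distinct gt) (proj1 gt) s0.
rewrite (prod_ratio_qshiftV gs' tz) sumrB in sumE; rewrite IHk //.
under [X in _ - _ * (_ * (_ * X) * _) = _]eq_bigr do rewrite mul1r.
rewrite [in RHS]big_ord_recr /= expfzDr // expr1z /Phi.
transitivity (eA K s (nt t) * fA K (qshift s (nt t)) (addv a (nt t)) *
  (\sum_(i < K) (qshift s (nt t) i)^-1 + (s K)^-1 * q ^ (- a K)
   - (\sum_(i < K) R i (nt t)) * ((s K)^-1 * q ^ (- a K)))).
  by rewrite /R; field; rewrite q0 s0.
by rewrite sumE; ring.
Qed.

(* Coefficient of x^a on the right-hand side of the theorem; |t| = - sum a because
   the A-type function is homogeneous of degree 0. *)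
Definition gB k s (a : nat -> int) :=
  \sum_(t <- compz k (- \sum_(i < k) a i)) eB k s (nt t) * fA k (qshift s (nt t)) (addv a (nt t)).

Lemma sum_transfer k (a : nat -> int) i : (i.+1 < k)%N -> \sum_(j < k) transfer a i j = \sum_(j < k) a j.
Proof.
move=> ik; rewrite /transfer sumrB big_split /=.
have delta j : (j < k)%N -> \sum_(l < k) (j == l)%:Z = 1 :> int.
  move=> jk; rewrite (bigD1 (Ordinal jk)) //= eqxx big1 ?addr0 // => l.
  by rewrite -val_eqE eq_sym /= => /negbTE ->.
by rewrite !delta ?addrK // ltnW.
Qed.

Lemma sum_addv_unitv k (a : nat -> int) :
  \sum_(j < k.+1) addv a (unitv k) j = \sum_(j < k.+1) a j + 1.
Proof.
rewrite !big_ord_recr /= [addv _ _ k]/addv /unitv eqxx addrA; congr (_ + _ + _).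
by apply: eq_bigr => j _; rewrite /addv gtn_eqF ?addr0.
Qed.

Lemma gB_unitv_last k s (a : nat -> int) :
  gB k.+1 s (addv a (unitv k)) = \sum_(t <- compz k.+1 (- \sum_(i < k.+1) a i - 1))
    eB k.+1 s (nt t) * fA k.+1 (qshift s (nt t)) (addv (addv a (nt t)) (unitv k)).
Proof.
by rewrite /gB sum_addv_unitv opprD; apply: eq_bigr => t _; rewrite addvC.
Qed.

Lemma gB_transfer k s (a : nat -> int) i : (i < k)%N ->
  gB k.+1 s (transfer a i) = \sum_(t <- compz k.+1 (- \sum_(i < k.+1) a i))
    eB k.+1 s (nt t) * fA k.+1 (qshift s (nt t)) (addv (transfer a i) (nt t)).
Proof. by move=> ik; rewrite /gB sum_transfer. Qed.

Lemma generic2_qshift k s t i j : generic k s -> generic2 k s ->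
  (i < k)%N -> (j < k)%N -> qshift s t i * qshift s t j != 1.
Proof.
move=> [s0 _] g2 ik jk; apply: contraNneq (g2 i j (t i + t j)%N ik jk) => h.
have -> : s i * s j = q ^+ (t i + t j) * (qshift s t i * qshift s t j).
  by rewrite /qshift exprD; field; rewrite !expf_neq0.
by rewrite h mulr1 divff ?expf_neq0.
Qed.

(** No variable is added here. On the branch t the two A operators give the sum of the v_i + 1/v_i,
    and the term s_N x_N^{-1} T_N, after the weighted Pieri rule, gives exactly the difference to
    the sum of the s_i + 1/s_i. *)
Lemma DB_gB k s (a : nat -> int) : generic k.+1 s -> generic2 k.+1 s ->
  DA k.+1 s (gB k.+1 s) a + DAbar k.+1 s (gB k.+1 s) a
    - s k * q ^ (a k + 1) * gB k.+1 s (addv a (unitv k))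
  = (\sum_(i < k.+1) (s i + (s i)^-1)) * gB k.+1 s a.
Proof.
move=> gs g2; have [s0 _] := gs; set K := k.+1 in gs g2 s0 *.
pose z := - \sum_(i < K) a i; pose Phi t := fA K (qshift s t) (addv a t).
rewrite (@DA_branch K s (compz K z) (fun t => eB K s (nt t)) _
  (fun t => fA K (qshift s (nt t)))) //; last by move=> i ik; rewrite gB_transfer.
rewrite (@DAbar_branch K s (compz K z) (fun t => eB K s (nt t)) _
  (fun t => fA K (qshift s (nt t)))) //; last by move=> i ik; rewrite gB_transfer.
rewrite gB_unitv_last -/K mulr_sumr.
pose R (i : nat) t := \prod_(j < K) (rho1 s (qshift s t) i j * rhoB s (qshift s t) i j).
have -> : \sum_(t <- compz K (z - 1)) s k * q ^ (a k + 1) *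
    (eB K s (nt t) * fA K (qshift s (nt t)) (addv (addv a (nt t)) (unitv k)))
  = \sum_(t <- compz K (z - 1)) eB K s (nt t) *
    \sum_(i < K) (q * qshift s (incr (nt t) i) i)
      * (pieri K (qshift s (nt t)) i * Phi (incr (nt t) i)).
  apply: eq_bigr => t _; rewrite mulrCA -(qshift_addv s (nt t)) fA_pieri_weighted.
    congr (_ * _); apply: eq_bigr => i _.
    by rewrite qshift_incr_id mulVKf // qshift_addv_unitv.
  exact: generic_qshift.
rewrite (@lower_sum K s _ (eB K s) Phi R (fun i t => q * qshift s t i)); first last.
- by move=> i t iK ti; rewrite /R big_split /= (rho1_extra0 _ gs).
- by move=> t i; apply: eB_incr.
rewrite subrK /gB -/z mulr_sumr -!big_split -sumrB; apply: eq_big_seq => t tz /=.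
have gt := generic_qshift (nt t) gs.
rewrite DA_fA // DAbar_fA //.
rewrite [X in q^-1 * X](_ : _ = q * \sum_(i < K) qshift s (nt t) i * R i (nt t)).
  rewrite mulKf // sum_rhoB //; first last.
  - by move=> i j ik jk; apply: generic2_qshift ik jk.
  - by case: gt.
  - exact: generic_distinct.
  by rewrite sumrB !big_split /= /Phi; ring.
by rewrite mulr_sumr; apply: eq_bigr => i _; rewrite [RHS]mulrA.
Qed.

Lemma sum_addv k (a : nat -> int) (t : nat -> nat) :
  \sum_(i < k) addv a t i = \sum_(i < k) a i + (\sum_(i < k) t i)%:Z.
Proof. by rewrite big_split /= (big_morph Posz PoszD (erefl _)). Qed.

(** The series involves only nonnegative powers of the x_{j+1}/x_j, and a partial sum of exponents
    is minus such a power. This is what reconciles untruncated exponent vectors with [ymul], which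
    returns 0 at exponent 0. *)
Lemma fA_support k s (a : nat -> int) : fA k s a != 0 ->
  \sum_(i < k) a i = 0 /\ (forall j, (j <= k)%N -> \sum_(i < j) a i <= 0).
Proof.
elim: k s a => [|k IHk] s a.
  by move=> _; split=> [|j]; rewrite ?big_ord0 // leqn0 => /eqP ->; rewrite big_ord0.
rewrite fA_S => nz.
have [t tz /IHk [sum0 sumle]] : exists2 t, t \in compz k (a k) &
    fA k (qshift s (nt t)) (addv a (nt t)) != 0.
  apply/hasP; apply: contraNT nz => /hasPn h; rewrite big1_seq // => t /andP [_ /h].
  by rewrite negbK => /eqP ->; rewrite mulr0.
have sum1 : \sum_(i < k.+1) a i = 0.
  rewrite big_ord_recr /=; move: sum0; rewrite sum_addv.
  by have /compzP [st <-] := tz; rewrite sumnE (big_nth 0%N) st big_mkord.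
split=> // j; rewrite leq_eqVlt => /predU1P [->|]; first by rewrite sum1.
rewrite ltnS => jk; apply: le_trans (sumle j jk); rewrite sum_addv lerDl //.
Qed.

Lemma gB_support k s (a : nat -> int) : gB k s a != 0 ->
  forall j, (j <= k)%N -> \sum_(i < j) a i <= 0.
Proof.
move=> nz j jk.
have [t _ /fA_support [_ sumle]] : exists2 t, t \in compz k (- \sum_(i < k) a i) &
    fA k (qshift s (nt t)) (addv a (nt t)) != 0.
  apply/hasP; apply: contraNT nz => /hasPn h; rewrite /gB big1_seq // => t /andP [_ /h].
  by rewrite negbK => /eqP ->; rewrite mulr0.
by apply: le_trans (sumle j jk); rewrite sum_addv lerDl.
Qed.

End Weights.

(** * The coefficients of the paper *)

Section Conversion.
Variables (F : fieldType) (q : F).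
Hypothesis q0 : q != 0.

Lemma prod_row k i (G : nat -> F) : (i < k)%N -> (forall j, (j < i)%N -> G j = 1) ->
  \prod_(j < k) G j = G i * \prod_(i.+1 <= j < k) G j.
Proof.
move=> ik G1; rewrite -(big_mkord predT G) -big_ltn //.
rewrite (@big_cat_nat _ _ _ i) ?(ltnW ik) //= big_nat big1 ?mul1r //.
Qed.

Lemma qshift_ratio S T i j :
  q ^ ((T j)%:Z - (T i)%:Z) * q * S i / S j = q * (qshift q S T i / qshift q S T j).
Proof.
rewrite /qshift expfzDr // -invr_expz -!exprnP [(q ^- T j * S j)^-1]invfM invrK; ring.
Qed.

(** Row [i] has one diagonal factor q^{t_i} and k - i - 1 pair factors q^{t_i}, hence the exponent k
    - i. *)
Lemma WA_rows k s t : WA q k s t = \prod_(i < k)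
  (q ^+ ((k - i) * t i) / qpoch q q (t i) * \prod_(i.+1 <= j < k)
     (qpoch q (q * (s j / s i)) (t i)
      * qpoch q (q * (qshift q s t i / qshift q s t j)) (t i))^-1).
Proof.
apply: eq_bigr => i _; rewrite (prod_row (i := i) (G := wA q s t i)) // => [|j ji]; last first.
  by rewrite /wA gtn_eqF // ltnNge ltnW.
rewrite {1}/wA eqxx [X in _ * X = _](_ : _ = \prod_(i.+1 <= j < k) (q ^+ t i *
    (qpoch q (q * (s j / s i)) (t i)
      * qpoch q (q * (qshift q s t i / qshift q s t j)) (t i))^-1)).
  rewrite big_split /= prodr_const_nat -exprM mulrA; congr (_ * _).
  rewrite mulrAC -exprD; congr (q ^+ _ / _).
  by rewrite subnS -mulnS prednK ?subn_gt0 // mulnC.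
by apply: eq_big_nat => j /andP [ij _]; rewrite /wA ltn_eqF // ij.
Qed.

Lemma eBA_eB k T S : eBA k T S q = eB q k (fun i => S i.+1) (fun i => T i.+1).
Proof.
rewrite /eBA /eB WA_rows -[WB _ _ _ _]/(\prod_(i < k) _) !big_add1 !big_mkord -!big_split.
apply: eq_bigr => i _ /=; rewrite [in LHS]big_add1 /=.
set s := fun i => S i.+1; set t := fun i => T i.+1.
rewrite (prod_row (i := i) (G := wB q s t i)) // => [|j ji]; last first.
  by rewrite /wB gtn_eqF // ltnNge ltnW.
rewrite {1}/wB eqxx [X in _ * (_ * X)](_ : _ = \prod_(i.+1 <= j < k)
   (qpoch q (q / (s i * s j)) (t i + t j)
    / (qpoch q (q / (s i * s j)) (t i) * qpoch q (q / (s i * s j)) (t j)))); last first.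
  by apply: eq_big_nat => j /andP [ij _]; rewrite /wB ltn_eqF // ij.
rewrite [in LHS]big_split /= addn1 subnSK // invfM.
rewrite [X in _ * (X * _) = _](_ : _ = \prod_(i.+1 <= j < k)
   (qpoch q (q * (s j / s i)) (t i) *
    qpoch q (q * (qshift q s t i / qshift q s t j)) (t i))^-1); first by rewrite /s /t; ring.
apply: eq_bigr => j _; rewrite -[q * S j.+1 / _]mulrA.
by have -> := qshift_ratio S T i.+1 j.+1.
Qed.

Lemma tailsumS K th i k : (k <= K)%N ->
  tailsum K.+1 th i k = tailsum K th i k + (th i K.+1)%:Z.
Proof. by move=> kK; rewrite /tailsum big_nat_recr //= PoszD. Qed.

Lemma tailsum_last K th i : tailsum K th i K = 0.
Proof. by rewrite /tailsum big_geq. Qed.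

(** In the form of [cToda] the two symbols carry j + 1 and j. The separate factor with s_k is thus
    the top term of the first product, and the diagonal (q; q) the term j = i of the second. *)
Lemma eA_rows k (s : nat -> F) (t : nat -> nat) : (forall i, (i < k)%N -> s i != 0) ->
  eA q k s t = \prod_(i < k) \prod_(i <= j < k)
    ((qpoch q (q * (s j.+1 / s i)) (t i))^-1
     * (q ^+ t i / qpoch q (q * (qshift q s t i / qshift q s t j)) (t i))).
Proof.
move=> s0; rewrite /eA WA_rows -big_split; apply: eq_bigr => i _ /=.
pose A j := (qpoch q (q * (s j / s i)) (t i))^-1.
pose B j := (qpoch q (q * (qshift q s t i / qshift q s t j)) (t i))^-1.
have Bi : B i = (qpoch q q (t i))^-1.
  by rewrite /B divff ?mulr1 // mulf_neq0 ?s0 // invr_eq0 expf_neq0.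
transitivity (\prod_(i <= j < k) A j.+1 * (q ^+ ((k - i) * t i) * \prod_(i <= j < k) B j)).
  have -> : \prod_(i <= j < k) A j.+1 = \prod_(i.+1 <= j < k.+1) A j by rewrite big_add1.
  rewrite big_nat_recr //= [\prod_(i <= j < k) B j]big_ltn //.
  rewrite Bi [X in _ * X * _ = _](_ : _ =
    \prod_(i.+1 <= j < k) A j * \prod_(i.+1 <= j < k) B j); first by rewrite /A; ring.
  by rewrite -big_split; apply: eq_bigr => j _; rewrite invfM.
rewrite mulnC exprM -prodr_const_nat -!big_split.
by apply: eq_bigr.
Qed.

Lemma cToda_ext K th th' S S' :
  (forall i j, (0 < i)%N -> (0 < j <= K)%N -> th i j = th' i j) ->
  (forall i, (0 < i)%N -> S i = S' i) ->
  cToda K th S q = cToda K th' S' q.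
Proof.
move=> tt' SS'; have tsE i k : (0 < i)%N -> tailsum K th i k = tailsum K th' i k.
  move=> i0; rewrite /tailsum; congr Posz; apply: eq_big_nat => a /andP [ka aK].
  by apply: tt' => //; rewrite (leq_ltn_trans _ ka).
apply: eq_big_nat => k /andP [k2 kK]; apply: eq_big_nat => i /andP [i1 ik].
apply: eq_big_nat => j /andP [ij jk].
have j1 := leq_trans i1 ij.
have k1 : (0 < k <= K)%N by rewrite (leq_trans _ k2).
by rewrite !tt' // !tsE // !SS'.
Qed.

(** In the last column all tail sums vanish and the factor is [eA]. In the earlier columns each tail
    sum contains one entry of the last column, which the shifted parameters absorb. *)
Lemma cToda_recr K th S : (forall i, (i < K)%N -> S i.+1 != 0) ->
  cToda K.+1 th S q = eA q K (fun i => S i.+1) (fun i => th i.+1 K.+1)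
                      * cToda K th (fun i => q ^- th i K.+1 * S i) q.
Proof.
move=> S0; have last : \prod_(1 <= i < K.+1) \prod_(i <= j < K.+1)
    ( (qpoch q (q ^ (tailsum K.+1 th i K.+1 - tailsum K.+1 th j.+1 K.+1) * q * S j.+1 / S i)
             (th i K.+1))^-1
      * (q ^+ th i K.+1
         / qpoch q (q ^ ((th j K.+1)%:Z - (th i K.+1)%:Z
              - (tailsum K.+1 th i K.+1 - tailsum K.+1 th j K.+1)) * q * S i / S j)
                 (th i K.+1)) )
  = eA q K (fun i => S i.+1) (fun i => th i.+1 K.+1).
  rewrite eA_rows // big_add1 big_mkord; apply: eq_bigr => i _ /=.
  rewrite big_add1; apply: eq_big_nat => j _ /=; rewrite !tailsum_last subr0 expr0z mul1r.
  rewrite !subr0 (qshift_ratio S (fun i => th i K.+1) i.+1 j.+1).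
  by rewrite -[q * _ / _]mulrA.
(* For [K = 0] the outer product is empty and has no last factor to split off. *)
case: K S0 last => [|K] S0 last.
  by rewrite -last /cToda !big_geq // mulr1.
rewrite -last /cToda big_nat_recr //= mulrC; congr (_ * _).
have shiftE x y z :
    q ^ (z + ((th x K.+2)%:Z - (th y K.+2)%:Z)) * q * S y / S x
    = q ^ z * q * (q ^- th y K.+2 * S y) / (q ^- th x K.+2 * S x).
  rewrite expfzDr // [q ^ (_ - _)]expfzDr // -[q ^ (- _)]invr_expz -!exprnP.
  by rewrite [(_ * S x)^-1]invfM invrK; ring.
apply: eq_big_nat => k /andP [k2]; rewrite ltnS => kK.
apply: eq_bigr => i _; apply: eq_bigr => j _; rewrite !(tailsumS _ _ kK).
set ti := tailsum _ _ i k; set tj := tailsum _ _ j k; set tj1 := tailsum _ _ j.+1 k.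
have -> : ti + (th i K.+2)%:Z - (tj1 + (th j.+1 K.+2)%:Z)
        = ti - tj1 + ((th i K.+2)%:Z - (th j.+1 K.+2)%:Z) by ring.
have -> : (th j k)%:Z - (th i k)%:Z - (ti + (th i K.+2)%:Z - (tj + (th j K.+2)%:Z))
        = (th j k)%:Z - (th i k)%:Z - (ti - tj) + ((th j K.+2)%:Z - (th i K.+2)%:Z) by ring.
by rewrite !shiftE.
Qed.

End Conversion.

(** * Matrices as lists of columns *)

Section Matrices.
Variables (F : fieldType) (q : F).
Hypothesis q0 : q != 0.

(* Strictly upper triangular matrices as lists of columns, column j having its j
   entries above the diagonal; the monomial they contribute is x^a. *)
Fixpoint mats k (a : nat -> int) : seq (seq (seq nat)) :=
  if k is k'.+1 then
    [seq rcons c t | t <- compz k' (a k'), c <- mats k' (addv a (nt t))]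
  else [:: [::]].

Definition ent (c : seq (seq nat)) i j := nth 0%N (nth [::] c j) i.

Lemma matsS k a : mats k.+1 a =
  [seq rcons c t | t <- compz k (a k), c <- mats k (addv a (nt t))].
Proof. by []. Qed.

Lemma size_mats k a c : c \in mats k a -> size c = k.
Proof.
elim: k a c => [|k IHk] a c; first by rewrite inE => /eqP ->.
by rewrite matsS => /allpairsPdep [t [d [_ /IHk sd ->]]]; rewrite size_rcons sd.
Qed.

Lemma mats_uniq k a : uniq (mats k a).
Proof.
elim: k a => [|k IHk] a //; rewrite matsS.
apply: allpairs_uniq_dep => [|t _|]; [exact: compz_uniq|exact: IHk|].
by move=> [t c] [t' c'] _ _ /= /rcons_inj [-> ->].
Qed.

(** The exponent of x_j in the product of the (x_j/x_i)^{c_ij} is a column sum minus a row sum;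
    equating it with a_j gives the second condition. *)
Lemma matsP k a c : reflect
  (size c = k /\ forall j, (j < k)%N -> size (nth [::] c j) = j /\
     (sumn (nth [::] c j))%:Z = a j + (\sum_(j.+1 <= l < k) ent c j l)%:Z)
  (c \in mats k a).
Proof.
elim: k a c => [|k IHk] a c.
  by rewrite inE; apply: (iffP eqP) => [->|[/size0nil]].
have entE d t j l : size d = k -> (l < k)%N -> ent (rcons d t) j l = ent d j l.
  by move=> sd lk; rewrite /ent nth_rcons sd lk.
have sumE d t j : size d = k -> (j < k)%N ->
   \sum_(j.+1 <= l < k.+1) ent (rcons d t) j l
   = (\sum_(j.+1 <= l < k) ent d j l + nt t j)%N.
  move=> sd jk; rewrite big_nat_recr //= {2}/ent nth_rcons sd ltnn eqxx; congr addn.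
  by apply: eq_big_nat => l /andP [_ lk]; rewrite entE.
rewrite matsS; apply: (iffP allpairsPdep) => [[t [d [tz dm ->]]]|[sc cP]].
  have sd := size_mats dm; split=> [|j]; first by rewrite size_rcons sd.
  rewrite ltnS leq_eqVlt nth_rcons sd => /predU1P [->|jk].
    by rewrite ltnn eqxx big_geq // addr0; apply/compzP.
  rewrite jk sumE //; have /IHk [_ /(_ j jk) [-> ->]] := dm.
  by rewrite /addv PoszD; split=> //; ring.
case/lastP: c sc cP => // d t; rewrite size_rcons => -[sd] cP.
exists t, d; split=> //.
  have := cP k (ltnSn k); rewrite nth_rcons sd ltnn eqxx big_geq // addr0.
  by move/compzP.
apply/IHk; split=> // j jk; have := cP j (ltnW jk).
rewrite nth_rcons sd jk sumE // PoszD /addv => -[-> ->]; split=> //; ring.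
Qed.

(** Every factor x_j/x_i has degree 0. This later determines the sum of theta from the monomial. *)
Lemma mats_sum0 k a c : c \in mats k a -> \sum_(i < k) a i = 0.
Proof.
elim: k a c => [|k IHk] a c; first by rewrite big_ord0.
rewrite matsS => /allpairsPdep [t [d [/compzP [st tz] /IHk sum0 _]]].
by rewrite big_ord_recr /= -tz -[RHS]sum0 sum_addv sumnE (big_nth 0%N) st big_mkord.
Qed.

Definition thmat c (i j : nat) := ent c i.-1 j.-1.

Lemma fA_mats k s a : generic q k s ->
  fA q k s a = \sum_(c <- mats k a) cToda k (thmat c) (fun i => s i.-1) q.
Proof.
elim: k s a => [|k IHk] s a gs; first by rewrite /= big_seq1 /cToda big_geq.
have gs' := generic_leq (leqnSn k) gs; have [s0 _] := gs'.
rewrite fA_S matsS big_allpairs_dep; apply: eq_bigr => t _.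
rewrite IHk; last exact: generic_qshift.
rewrite mulr_sumr; apply: eq_big_seq => c cm; have sc := size_mats cm.
rewrite cToda_recr //; congr (_ * _).
  congr (eA q k _ _); apply: functional_extensionality => i.
  by rewrite /thmat /ent nth_rcons sc ltnn eqxx.
apply: cToda_ext => [i j i0 /andP [j0 jk]|i _].
  by rewrite /thmat /ent nth_rcons sc prednK // jk.
by rewrite /thmat /ent nth_rcons sc ltnn eqxx.
Qed.

End Matrices.

(** * Uniqueness over Q(s, q) *)

(* Stated over an abstract field because [ring] and [field] unfold [Kfield n]. *)
Section FieldIdentities.
Variable F : fieldType.

Lemma cleared_eigenterm (x Q A B p : F) : x != 0 ->
  ((Q * A - Q) * x ^+ 2 + (Q * B - Q)) * p
  = (x * A + x^-1 * B - (x + x^-1)) * (Q * (x * p)).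
Proof. by move=> x0; field. Qed.

Lemma collect_diagonal (A YA sN TN YN s1 T1 B YB g : F) :
  (A * g - YA) + sN * (TN * g - YN) + s1 * (T1 * g) + (B * g - YB)
  = (A + sN * TN) * g + (s1 * T1 + B) * g - YA - sN * YN - YB.
Proof. by ring. Qed.

Lemma eigen_cancel (E L A Y B g g' : F) : E - L != 0 ->
  E * g - A - Y - B = L * g -> E * g' - A - Y - B = L * g' -> g = g'.
Proof.
move=> EL eg eg'; apply: (mulfI EL); rewrite !mulrBl -eg -eg'.
by rewrite !opprB !addrA; ring.
Qed.

End FieldIdentities.

Section Uniqueness.
Variable n : nat.
Local Notation N := n.+1.
Local Notation q := (qK n).
Local Notation s := (fun i => sK n i.+1).
Local Notation poly := {mpoly rat[n.+2]}.

(** One rational point certifies that two polynomials, hence their images among the rational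
    functions, differ. *)
Lemma tofrac_eval_neq (v : 'I_n.+2 -> rat) (p p' : poly) :
  p.@[v] != p'.@[v] -> (tofrac p : Kfield n) != tofrac p'.
Proof. by apply: contraNneq => /eqP; rewrite tofrac_eq => /eqP ->. Qed.

Lemma qKX m : q ^+ m = tofrac ('X_(inord 0) ^+ m : poly).
Proof. by rewrite tofracXn. Qed.

Lemma qK_neq0 : q != 0.
Proof.
rewrite -tofrac0; apply: (@tofrac_eval_neq (fun=> 1)).
by rewrite mevalXU meval0 oner_neq0.
Qed.

Lemma qK_unity m : (0 < m)%N -> q ^+ m != 1.
Proof.
move=> m0; rewrite qKX -tofrac1; apply: (@tofrac_eval_neq (fun=> 2%:R)).
rewrite rmorphXn /= mevalXU meval1 -natrX (eqr_nat _ _ 1) -(expn0 2) eqn_exp2l //.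
by rewrite -lt0n.
Qed.

Lemma sK_generic : generic q N s.
Proof.
have s0 i : s i != 0.
  rewrite -tofrac0; apply: (@tofrac_eval_neq (fun=> 1)).
  by rewrite mevalXU meval0 oner_neq0.
split=> // i j z iN jN ij.
(* At q = 1 the powers of [q] disappear, and the values 1 and 2 separate s_i from s_j. *)
pose v (l : 'I_n.+2) : rat := if l == inord j.+1 then 2%:R else 1.
have v0 : v (inord 0) = 1.
  by rewrite /v -val_eqE /= !inordK.
have vj : v (inord j.+1) = 2%:R by rewrite /v eqxx.
have vi : v (inord i.+1) = 1.
  by rewrite /v -val_eqE /= !inordK // eqSS (negbTE ij).
case: z => m.
  rewrite -exprnP qKX -tofracM; apply: (@tofrac_eval_neq v).
  by rewrite mevalM rmorphXn /= !mevalXU v0 vi vj expr1n mulr1 (eqr_nat _ 1 2).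
rewrite NegzE -invr_expz -exprnP; apply/negP => /eqP h.
have : q ^+ m.+1 * s j != s i.
  rewrite qKX -tofracM; apply: (@tofrac_eval_neq v).
  by rewrite mevalM rmorphXn /= !mevalXU v0 vi vj expr1n mul1r (eqr_nat _ 2 1).
by rewrite -h mulVKf ?eqxx // expf_neq0 ?qK_neq0.
Qed.

Lemma sK_generic2 : generic2 q N s.
Proof.
move=> i j l iN jN; have [s0 _] := sK_generic; apply/negP => /eqP h.
have : q ^+ l != s i * s j.
  (* At q = 1 and all s_i = 2 the two sides are 1 and 4. *)
  pose v (l : 'I_n.+2) : rat := if l == inord 0 then 1 else 2%:R.
  have vS k : (k < N)%N -> v (inord k.+1) = 2%:R by move=> kN; rewrite /v -val_eqE /= !inordK.
  rewrite qKX -tofracM; apply: (@tofrac_eval_neq v).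
  rewrite mevalM rmorphXn /= !mevalXU !vS // /v eqxx expr1n.
  by rewrite -natrM (eqr_nat _ 1 4).
by rewrite -[q ^+ l](divfK (mulf_neq0 (s0 i iN) (s0 j jN))) h mul1r eqxx.
Qed.

(* After clearing denominators, evaluate at q = 2, s_{i0} = 0 and all other s_i = 1:
   only the i0-th summand survives. *)
Lemma eigenvalue_neq (a : nat -> int) i0 : (i0 < N)%N -> a i0 != 0 ->
  \sum_(i < N) (s i * q ^ (a i) + (s i)^-1 * q ^ (- a i))
  != \sum_(i < N) (s i + (s i)^-1).
Proof.
move=> i0N a0; have [s0 _] := sK_generic; have q0 := qK_neq0.
(* A bound for all |a_i|: multiplying by q^M makes every exponent M + a_i and M - a_i a natural
   number. *)
pose M := (\sum_(i < N) absz (a i))%N.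
have aM (i : 'I_N) : (absz (a i) <= M)%N by rewrite /M (bigD1 i) //= leq_addr.
pose e i := absz (M%:Z + a i); pose e' i := absz (M%:Z - a i).
have eE (i : 'I_N) : q ^+ e i = q ^+ M * q ^ (a i).
  by rewrite [LHS]exprnP gez0_abs ?expfzDr //; have := aM i; lia.
have e'E (i : 'I_N) : q ^+ e' i = q ^+ M * q ^ (- a i).
  by rewrite [LHS]exprnP gez0_abs ?expfzDr //; have := aM i; lia.
pose X i : poly := 'X_(inord i).
pose P : poly := \sum_(i < N) ((X 0%N ^+ e i - X 0%N ^+ M) * X i.+1 ^+ 2
    + (X 0%N ^+ e' i - X 0%N ^+ M)) * \prod_(l < N | l != i) X l.+1.
have PE : tofrac P = (\sum_(i < N) (s i * q ^ (a i) + (s i)^-1 * q ^ (- a i))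
     - \sum_(i < N) (s i + (s i)^-1)) * (q ^+ M * \prod_(l < N) s l).
  rewrite /P rmorph_sum -sumrB mulr_suml; apply: eq_bigr => i _ /=.
  rewrite rmorphM rmorph_prod rmorphD rmorphM !rmorphB !rmorphXn /=.
  rewrite -[tofrac (X 0%N)]/q -[tofrac (X i.+1)]/(s i) eE e'E.
  rewrite [\prod_(l < N) s l](bigD1 i) //=.
  rewrite -[\prod_(l < N | l != i) tofrac _]/(\prod_(l < N | l != i) s l).
  exact: cleared_eigenterm (s0 i (ltn_ord i)).
pose v (l : 'I_n.+2) : rat :=
  if l == inord 0 then 2%:R else if l == inord i0.+1 then 0 else 1.
have vE i : (i < N)%N -> v (inord i.+1) = (i != i0)%:R.
  move=> iN; rewrite /v -!val_eqE /= !inordK //= eqSS; by case: eqP.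
have P0 : P.@[v] != 0.
  rewrite /P rmorph_sum (bigD1 (Ordinal i0N)) //= [X in _ + X]big1 ?addr0 => [|i ii0].
    rewrite mevalM mevalD mevalM !mevalB !rmorphXn /= !mevalXU vE // eqxx expr0n mulr0 add0r.
    rewrite rmorph_prod /= big1 ?mulr1 => [|l ll]; last first.
      by rewrite mevalXU vE //; move: ll; rewrite -val_eqE /= => ->.
    (* The surviving value is 2^{M - a} - 2^M with a = a_{i0}, nonzero because a is. *)
    rewrite /v eqxx -!natrX subr_eq0 eqr_nat eqn_exp2l // /e'.
    by have := aM (Ordinal i0N); move: a0 => /=; lia.
  rewrite mevalM rmorph_prod /= (bigD1 (Ordinal i0N)) ?[_ == i]eq_sym //= mevalXU vE // eqxx.
  by rewrite mul0r mulr0.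
rewrite -subr_eq0; apply: contraNneq P0 => h; apply/eqP.
suff -> : P = 0 by rewrite meval0.
by apply/eqP; rewrite -tofrac_eq0 PE h mul0r.
Qed.

(** The inverse shift of x_1 has no subtracted part, so it joins the diagonal as index 0 of the
    inverse sum. All other terms read [G] at a monomial of smaller degree. *)
Lemma DBToda_split (G : series n) m : DBToda G m =
  (\sum_(i < N) (s i * q ^ (xexp m i.+1) + (s i)^-1 * q ^ (- xexp m i.+1))) * G m
  - \sum_(i < n) s i * ymul i.+1 (Tq i.+1 1 G) m
  - s n * ymul N (Tq N 1 G) m
  - \sum_(i < n) (s i.+1)^-1 * ymul i.+1 (Tq i.+2 (-1) G) m.
Proof.
have mulS k (f g h : nat -> Kfield n) :
    \sum_(i < k) f i * (g i - h i) = \sum_(i < k) f i * g i - \sum_(i < k) f i * h i.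
  by rewrite -sumrB; apply: eq_bigr => i _; rewrite mulrBr.
rewrite /DBToda big_add1 /= [\sum_(2 <= i < _) _]big_add1 big_add1 /= !big_mkord.
rewrite (mulS n s (fun i => Tq i.+1 1 G m) (fun i => ymul i.+1 (Tq i.+1 1 G) m)).
rewrite (mulS n (fun i => (sK n i.+2)^-1) (fun i => Tq i.+2 (-1) G m)
  (fun i => ymul i.+1 (Tq i.+2 (-1) G) m)).
rewrite [in RHS]big_split /= [in RHS]mulrDl.
rewrite [X in _ = X * _ + _ - _ - _ - _]big_ord_recr.
rewrite [X in _ = _ + X * _ - _ - _ - _]big_ord_recl /=.
have -> : \sum_(i < n) sK n i.+1 * Tq i.+1 1 G m
        = (\sum_(i < n) sK n i.+1 * q ^ xexp m i.+1) * G m.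
  by rewrite mulr_suml; apply: eq_bigr => i _; rewrite /Tq mul1r mulrA.
have -> : \sum_(i < n) (sK n i.+2)^-1 * Tq i.+2 (-1) G m
        = (\sum_(i < n) (sK n (bump 0 i).+1)^-1 * q ^ (- xexp m (bump 0 i).+1)) * G m.
  by rewrite mulr_suml; apply: eq_bigr => i _; rewrite /Tq mulN1r mulrA.
by rewrite /Tq mul1r mulN1r collect_diagonal.
Qed.

Definition msum (m : mono n) := (\sum_i m i)%N.

Lemma msum_ydec m k : (0 < yexp m k)%N -> (msum (ydec m k) < msum m)%N.
Proof.
move=> mk; rewrite /msum (bigD1 (inord k.-1)) //= [X in (_ < X)%N](bigD1 (inord k.-1)) //=.
rewrite ffunE eqxx -/(yexp m k) -addSn prednK // leq_add2l.
by apply: eq_leq; apply: eq_bigr => i /negbTE ik; rewrite ffunE ik.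
Qed.

Lemma sum_xexp (m : mono n) j : (j < N)%N -> \sum_(i < j.+1) xexp m i.+1 = - (yexp m j.+1)%:Z.
Proof.
elim: j => [|j IHj] jN; first by rewrite big_ord1 /xexp sub0r.
by rewrite big_ord_recr /= IHj ?(ltnW jN) // /xexp /= addKr.
Qed.

(** By induction on the total degree in the y_i: the off-diagonal terms of the two equations agree,
    and the difference of diagonal coefficient and eigenvalue can be cancelled. *)
Lemma is_fBToda_unique (G G' : series n) :
  is_fBToda G -> is_fBToda G' -> forall m, G m = G' m.
Proof.
move=> [GD G1] [GD' G1'] m; move: {2}(msum m).+1 (ltnSn (msum m)) => b.
elim: b m => // b IHb m; rewrite ltnS => mb.
have ymulE k (i : nat) (e : int) : ymul k (Tq i e G) m = ymul k (Tq i e G') m.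
  rewrite /ymul /Tq; case: ifP => // mk; rewrite IHb //.
  exact: leq_trans (msum_ydec mk) mb.
have [/forallP m0|/forallPn [i0 mi0]] := boolP [forall i, m i == 0%N].
  suff -> : m = [ffun=> 0%N] by rewrite G1 G1'.
  by apply/ffunP => i; rewrite ffunE; apply/eqP.
(* The y-exponents are minus the partial sums of the x-exponents, so they cannot be nonzero when all
   x-exponents vanish. *)
have [i1 i1N ai1] : exists2 i1, (i1 < N)%N & xexp m i1.+1 != 0.
  have : [exists i : 'I_N, xexp m i.+1 != 0].
    apply: contraR mi0 => /existsPn h.
    have := sum_xexp m (ltn_ord i0).
    rewrite big1 => [|i _]; last first.
      have iN : (i < N)%N by rewrite (leq_trans (ltn_ord i)).
      by have := h (Ordinal iN); rewrite negbK => /eqP.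
    by rewrite /yexp /= inord_val => /esym/eqP; rewrite oppr_eq0.
  by case/existsP => i; exists i.
have := GD m; have := GD' m; rewrite !DBToda_split.
set E := \sum_(i < N) _; set A := \sum_(i < n) _; set B := \sum_(i < n) _.
set A' := \sum_(i < n) _; set B' := \sum_(i < n) _; set L := \sum_(1 <= i < _) _.
have -> : A' = A by apply: eq_bigr => i _; rewrite ymulE.
have -> : B' = B by apply: eq_bigr => i _; rewrite ymulE.
rewrite ymulE => eq1 eq2; have := eigenvalue_neq (a := fun i => xexp m i.+1) i1N ai1; rewrite -/E.
rewrite (_ : \sum_(i < N) _ = L); last by rewrite /L big_add1 big_mkord.
rewrite -subr_eq0 => EL0; exact: eigen_cancel EL0 eq2 eq1.
Qed.

End Uniqueness.
(** * The B-type function *)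

Section Main.
Variable n : nat.
Local Notation N := n.+1.
Local Notation q := (qK n).
Local Notation s := (fun i => sK n i.+1).

Definition xvec (m : mono n) i := xexp m i.+1.

Lemma gB_ext (F : fieldType) (p : F) k u a a' : (forall i, (i < k)%N -> a i = a' i) ->
  gB p k u a = gB p k u a'.
Proof.
move=> aa'; rewrite /gB (eq_bigr (fun i : 'I_k => a' i)) => [|i _]; last exact: aa'.
by apply: eq_bigr => t _; congr (_ * _); apply: fA_ext => // i ik; rewrite /addv aa'.
Qed.

Lemma yexp_ydec (m : mono n) k j : (k < N)%N -> (j < N)%N -> (0 < yexp m k.+1)%N ->
  (yexp (ydec m k.+1) j.+1)%:Z = (yexp m j.+1)%:Z - (k == j)%:Z.
Proof.
move=> kN jN mk; rewrite /yexp /= ffunE -val_eqE /= !inordK // eq_sym.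
case: eqVneq => [<-|_]; last by rewrite subr0.
move: mk; rewrite /yexp /=; case: (m (inord k)) => // x _.
by rewrite -[in RHS]addn1 PoszD addrK.
Qed.

Lemma xvec_ydec (m : mono n) k j : (k < N)%N -> (j < N)%N -> (0 < yexp m k.+1)%N ->
  xvec (ydec m k.+1) j = transfer (xvec m) k j.
Proof.
move=> kN jN mk; rewrite /xvec /transfer /xexp; case: j jN => [|j] jN.
  by rewrite yexp_ydec // subr0; ring.
by rewrite [j.+2.-1]/= !yexp_ydec ?(ltnW jN) // eqSS; ring.
Qed.

(** At y-exponent 0 the transfer makes a partial sum equal to 1, which lies outside the support. *)
Lemma gB_transfer_support (m : mono n) k : (k < N)%N -> yexp m k.+1 = 0%N ->
  gB q N s (transfer (xvec m) k) = 0.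
Proof.
move=> kN mk; apply/eqP; apply: contraTT isT => /gB_support /(_ k.+1 kN).
have -> : \sum_(i < k.+1) transfer (xvec m) k i = \sum_(i < k.+1) addv (xvec m) (unitv k) i.
  apply: eq_bigr => i _; rewrite /transfer /addv /unitv.
  by have -> : k.+1 == i = false by [rewrite gtn_eqF]; rewrite subr0.
by rewrite sum_addv_unitv sum_xexp // mk.
Qed.

Lemma gB_ymul (m : mono n) k (c : mono n -> Kfield n) c' : (k < N)%N ->
  ((0 < yexp m k.+1)%N -> c (ydec m k.+1) = c') ->
  ymul k.+1 (fun m => c m * gB q N s (xvec m)) m = c' * gB q N s (transfer (xvec m) k).
Proof.
move=> kN cE; rewrite /ymul; case: posnP => mk.
  by rewrite gB_transfer_support ?mulr0.
by rewrite cE //; congr (_ * _); apply: gB_ext => j jN; rewrite xvec_ydec.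
Qed.

Lemma collect_DB (F : fieldType) (E1 E2 g S1 Y S2 : F) :
  (E1 + E2) * g - S1 - Y - S2 = (E1 * g - S1) + (E2 * g - S2) - Y.
Proof. by ring. Qed.

Lemma transfer_id (a : nat -> int) i : transfer a i i = a i + 1.
Proof. by rewrite /transfer eqxx gtn_eqF // subr0. Qed.

Lemma transfer_next (a : nat -> int) i : transfer a i i.+1 = a i.+1 - 1.
Proof. by rewrite /transfer eqxx ltn_eqF // addr0. Qed.

(** Translation of the equation in exponent vectors: lowering a y-exponent is a transfer, and where
    [ymul] truncates to 0 the support already forces the coefficient to vanish. *)
Lemma gB_eigen m :
  DBToda (fun m => gB q N s (xvec m)) m
  = (\sum_(1 <= i < N.+1) (sK n i + (sK n i)^-1)) * gB q N s (xvec m).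
Proof.
have q0 := qK_neq0 n.
rewrite [\sum_(1 <= i < _) _]big_add1 big_mkord.
rewrite -(DB_gB q0 (@qK_unity n) (xvec m) (sK_generic n) (@sK_generic2 n)).
rewrite DBToda_split big_split collect_DB; congr (_ + _ - _).
- rewrite /DA mulr_suml; congr (_ - _); apply: eq_bigr => i _ /=.
  rewrite /Tq (@gB_ymul m i (fun m => q ^ (1 * xexp m i.+1)) (q ^ (xvec m i + 1))) ?mulrA //; first by rewrite ltnS ltnW.
  by move=> mi; rewrite mul1r -/(xvec _ i) xvec_ydec ?transfer_id // ltnS ltnW.
- rewrite /DAbar mulr_suml; congr (_ - _); apply: eq_bigr => i _ /=.
  rewrite /Tq (@gB_ymul m i (fun m => q ^ (-1 * xexp m i.+2)) (q ^ (1 - xvec m i.+1))) ?mulrA //; first by rewrite ltnS ltnW.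
  move=> mi; rewrite mulN1r -/(xvec _ i.+1) xvec_ydec ?transfer_next ?opprB //.
    by rewrite ltnS ltnW.
  by rewrite ltnS ltn_ord.
rewrite /Tq (@gB_ymul m n (fun m => q ^ (1 * xexp m N)) (q ^ (xvec m n + 1))) ?mulrA //.
  (* For the last variable [transfer] also lowers coordinate N, which lies beyond the coordinates
     that [gB] reads. *)
  congr (_ * _); apply: gB_ext => j jN; rewrite /transfer /addv /unitv.
  by have -> : N == j = false by [rewrite gtn_eqF]; rewrite subr0.
by move=> mi; rewrite mul1r -/(xvec _ n) xvec_ydec // transfer_id.
Qed.

(** * The constant term *)

Lemma comps0 k : comps k 0 = [:: nseq k 0%N].
Proof. by elim: k => //= k ->. Qed.

Lemma weights0 (F : fieldType) (p : F) k u :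
  eA p k u (nt (nseq k 0%N)) = 1 /\ eB p k u (nt (nseq k 0%N)) = 1.
Proof.
have nt0 i : nt (nseq k 0%N) i = 0%N by rewrite /nt nth_nseq if_same.
have qp0 a : qpoch p a 0 = 1 by rewrite /qpoch big_ord0.
have WA1 : WA p k u (nt (nseq k 0%N)) = 1.
  apply: big1 => i _; apply: big1 => j _.
  by rewrite /wA !nt0 !qp0 expr0 mulr1 invr1 mulr1 !if_same.
have WB1 : WB p k u (nt (nseq k 0%N)) = 1.
  apply: big1 => i _; apply: big1 => j _.
  by rewrite /wB !nt0 addn0 !qp0 !(mulr1, invr1) !if_same.
split; last by rewrite /eB WA1 WB1 mulr1.
by rewrite /eA WA1 mul1r; apply: big1 => i _; rewrite nt0 qp0 invr1.
Qed.

Lemma fA0 (F : fieldType) (p : F) k u a : (forall i, (i < k)%N -> a i = 0) ->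
  fA p k u a = 1.
Proof.
elim: k u a => // k IHk u a a0; rewrite fA_S a0 //= comps0 big_seq1.
rewrite (proj1 (weights0 p k u)) mul1r IHk // => i ik.
by rewrite /addv a0 ?ltnS ?(ltnW ik) // /nt nth_nseq if_same.
Qed.

Lemma gB_const : gB q N s (xvec [ffun=> 0%N]) = 1.
Proof.
have a0 i : xvec [ffun=> 0%N] i = 0.
  by rewrite /xvec /xexp /yexp; case: i => [|i]; rewrite !ffunE subr0.
have sum0 : \sum_(i < N) xvec [ffun=> 0%N] i = 0 by apply: big1 => i _; apply: a0.
rewrite /gB sum0 oppr0 -[compz _ _]/(comps N 0) comps0 big_seq1.
rewrite (proj2 (weights0 q N s)) mul1r fA0 // => i iN.
by rewrite /addv a0 /nt nth_nseq if_same.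
Qed.

Lemma gB_is_fBToda : is_fBToda (fun m : mono n => gB q N s (xvec m)).
Proof. by split; [exact: gB_eigen|exact: gB_const]. Qed.

(** * The index set of the right-hand side *)

Definition tovec (t : seq nat) : {ffun 'I_N -> nat} := [ffun i : 'I_N => nth 0%N t i].
Definition tomat (c : seq (seq nat)) : {ffun 'I_N * 'I_N -> nat} :=
  [ffun p : 'I_N * 'I_N => ent c p.1 p.2].

Lemma vec_ofE (th : {ffun 'I_N -> nat}) (i : 'I_N) : vec_of th i.+1 = th i.
Proof. by rewrite /vec_of /= ltn_ord inord_val. Qed.

Lemma mat_ofE (t : {ffun 'I_N * 'I_N -> nat}) (i j : 'I_N) : mat_of t i.+1 j.+1 = t (i, j).
Proof. by rewrite /mat_of /= !ltn_ord !inord_val. Qed.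

Lemma vec_of_tovec t i : size t = N -> (0 < i)%N -> vec_of (tovec t) i = nt t i.-1.
Proof.
move=> st; case: i => // i _; rewrite /vec_of /= /nt.
case: ltnP => iN; first by rewrite ffunE inordK.
by rewrite nth_default ?st.
Qed.

Lemma mat_of_tomat a c i j : c \in mats N a -> (0 < i)%N -> (0 < j <= N)%N ->
  mat_of (tomat c) i j = thmat c i j.
Proof.
move=> /matsP [sc cP]; case: i j => [|i] [|j] //= _ jN.
rewrite /mat_of /= jN andbT /thmat /=; case: ltnP => iN.
  by rewrite ffunE /= !inordK.
have [sj _] := cP j jN.
by rewrite /ent nth_default // sj (leq_trans _ iN) // -ltnS ltnW.
Qed.

Lemma strict_upper_tomat a c : c \in mats N a -> strict_upper (tomat c).
Proof.
move=> /matsP [sc cP]; apply/forallP => i; apply/forallP => j; apply/implyP => ji.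
by rewrite ffunE /= /ent nth_default //; have [-> _] := cP j (ltn_ord j).
Qed.

Lemma mono_match_tomat m t c : t \in compz N (- \sum_(i < N) xvec m i) ->
  c \in mats N (addv (xvec m) (nt t)) -> mono_match (tovec t) (tomat c) m.
Proof.
move=> /compzP [st _] cm; have /matsP [sc cP] := cm; apply/forallP => k; apply/eqP.
have kN : (0 < k.+1 <= N)%N := ltn_ord k.
rewrite vec_of_tovec //= big_add1 big_mkord.
rewrite (eq_bigr (fun i : 'I_k => nth 0%N (nth [::] c k) i)) => [|i _]; last first.
  by rewrite (mat_of_tomat cm).
have [sk sumk] := cP k (ltn_ord k).
have -> : (\sum_(i < k) nth 0%N (nth [::] c k) i)%N = sumn (nth [::] c k).
  by rewrite sumnE (big_nth 0%N) sk big_mkord.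
have -> : (\sum_(k.+2 <= j < N.+1) mat_of (tomat c) k.+1 j
           = \sum_(k.+1 <= l < N) ent c k l)%N.
  by rewrite big_add1 /=; apply: eq_big_nat => l /andP [_ lN]; rewrite (mat_of_tomat cm).
by rewrite sumk /addv -/(xvec m k); ring.
Qed.

Lemma rhs_term_tomat m t c : t \in compz N (- \sum_(i < N) xvec m i) ->
  c \in mats N (addv (xvec m) (nt t)) ->
  rhs_term m (tovec t, tomat c)
  = eB q N s (nt t) * cToda N (thmat c) (fun i => qshift q s (nt t) i.-1) q.
Proof.
move=> tz cm; have /compzP [st _] := tz.
rewrite /rhs_term /= (strict_upper_tomat cm) (mono_match_tomat tz cm) /=.
rewrite eBA_eB ?qK_neq0 //; congr (eB _ _ _ _ * _).
  by apply: functional_extensionality => i; rewrite vec_of_tovec.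
apply: cToda_ext => [i j i0 jN|i i0]; first by rewrite (mat_of_tomat cm).
by rewrite /qshift vec_of_tovec // prednK.
Qed.

Definition rhs_index m :=
  [seq (tovec t, tomat c) | t <- compz N (- \sum_(i < N) xvec m i),
                            c <- mats N (addv (xvec m) (nt t))].

Lemma rhs_index_uniq m : uniq (rhs_index m).
Proof.
apply: allpairs_uniq_dep => [|t _|]; [exact: compz_uniq|exact: mats_uniq|].
move=> x y /allpairsPdep [t [c [/compzP [st _] /matsP [sc cP] ->]]].
move=> /allpairsPdep [u [d [/compzP [su _] /matsP [sd dP] ->]]] /= [tu cd].
have {}tu : t = u.
  apply: (@eq_from_nth _ 0%N) => [|i]; first by rewrite st su.
  rewrite st => iN; have := congr1 (fun f : {ffun 'I_N -> nat} => f (Ordinal iN)) tu.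
  by rewrite !ffunE.
suff -> : c = d by rewrite tu.
apply: (@eq_from_nth _ [::]) => [|j]; first by rewrite sc sd.
rewrite sc => jN; have [sj _] := cP j jN; have [sj' _] := dP j jN.
apply: (@eq_from_nth _ 0%N) => [|i]; first by rewrite sj sj'.
rewrite sj => ij; have iN := ltn_trans ij jN.
have := congr1 (fun f : {ffun 'I_N * 'I_N -> nat} => f (Ordinal iN, Ordinal jN)) cd.
by rewrite !ffunE.
Qed.

(** The lists are read off from [th] and [t], column j being cut to its j entries above the
    diagonal; strict triangularity makes the cut lossless. *)
Lemma rhs_index_complete m th t :
  strict_upper t -> mono_match th t m -> (th, t) \in rhs_index m.
Proof.
move=> /forallP up /forallP mm.
pose v := mkseq (fun i => th (inord i)) N.
pose c := mkseq (fun j => mkseq (fun i => t (inord i, inord j)) j) N.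
have vE : tovec v = th.
  by apply/ffunP => i; rewrite ffunE nth_mkseq // inord_val.
have entE (i j : 'I_N) : ent c i j = t (i, j).
  rewrite /ent nth_mkseq //; case: (ltnP i j) => ij; first by rewrite nth_mkseq // !inord_val.
  rewrite nth_default ?size_mkseq //.
  by have /forallP/(_ j)/implyP/(_ ij)/eqP -> := up i.
have cE : tomat c = t by apply/ffunP => -[i j]; rewrite ffunE /= entE.
have cm : c \in mats N (addv (xvec m) (nt v)).
  apply/matsP; split=> [|j jN]; first by rewrite size_mkseq.
  split; first by rewrite nth_mkseq // size_mkseq.
  have /eqP := mm (Ordinal jN); rewrite /= -/(xvec m j) => amE.
  rewrite /addv -amE (vec_ofE th (Ordinal jN)).
  have -> : nt v j = th (Ordinal jN).
    by rewrite /nt nth_mkseq //; congr (th _); apply: val_inj; rewrite /= inordK.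
  have -> : sumn (nth [::] c j) = (\sum_(1 <= i < j.+1) mat_of t i j.+1)%N.
    rewrite sumnE (big_nth 0%N) nth_mkseq // size_mkseq big_add1 /= !big_mkord.
    apply: eq_bigr => i _; have iN := ltn_trans (ltn_ord i) jN.
    rewrite nth_mkseq // (mat_ofE t (Ordinal iN) (Ordinal jN)).
    by congr (t (_, _)); apply: val_inj; rewrite /= inordK.
  have -> : (\sum_(j.+2 <= l < N.+1) mat_of t j.+1 l = \sum_(j.+1 <= l < N) ent c j l)%N.
    rewrite big_add1 /=; apply: eq_big_nat => l /andP [_ lN].
    by rewrite (mat_ofE t (Ordinal jN) (Ordinal lN)) -entE.
  by ring.
apply/allpairsPdep; exists v, c; split=> //; last by rewrite vE cE.
apply/compzP; split; first by rewrite size_mkseq.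
(* The matrix part has degree 0, so the sum of theta is minus the degree of the monomial. *)
have := mats_sum0 cm; rewrite sum_addv addrC => /eqP; rewrite addr_eq0 => /eqP <-.
by rewrite sumnE (big_nth 0%N) size_mkseq big_mkord.
Qed.

Lemma sums_to_gB m : sums_to (rhs_term m) (gB q N s (xvec m)).
Proof.
exists (rhs_index m); split.
- exact: rhs_index_uniq.
- move=> [th t] ni; rewrite /rhs_term /=; case: ifP => // /andP [up mm].
  by rewrite rhs_index_complete in ni.
rewrite big_allpairs_dep; apply: eq_big_seq => t tz.
rewrite (fA_mats (qK_neq0 n)); last exact/generic_qshift/sK_generic/qK_neq0.
rewrite mulr_sumr; apply: eq_big_seq => c cm.
by rewrite rhs_term_tomat.
Qed.

End Main.

(** Each of the two lists may be cut down to their common elements, since the family vanishes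
    outside the other list. *)
Lemma sums_to_unique (F : fieldType) (I : eqType) (fam : I -> F) v w :
  sums_to fam v -> sums_to fam w -> v = w.
Proof.
move=> [r [ur r0 ->]] [r' [ur' r0' ->]].
have restrict (l l' : seq I) : (forall i, i \notin l' -> fam i = 0) ->
    \sum_(i <- l) fam i = \sum_(i <- [seq i <- l | i \in l']) fam i.
  move=> l0; rewrite big_filter (bigID (mem l')) /= [X in _ + X]big1 ?addr0 //.
rewrite (restrict r r') // [RHS](restrict r' r) //; apply/perm_big/uniq_perm.
- exact: filter_uniq.
- exact: filter_uniq.
by move=> i; rewrite !mem_filter andbC.
Qed.

(* N = n.+1 >= 1.  The coefficient family of the right-hand side is
   summable at every monomial, and a series is the B_N q-Toda function iff
   its coefficients are given by the right-hand side. *)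
Theorem theorem2p7 (n : nat) :
  (forall m : mono n, exists v, sums_to (rhs_term m) v) /\
  (forall G : series n,
     is_fBToda G <-> forall m : mono n, sums_to (rhs_term m) (G m)).
Proof.
split=> [m|G]; first by eexists; apply: sums_to_gB.
split=> [fG m|GE].
  by rewrite (is_fBToda_unique fG (gB_is_fBToda n) m); apply: sums_to_gB.
suff -> : G = fun m => gB (qK n) n.+1 (fun i => sK n i.+1) (xvec m).
  exact: gB_is_fBToda.
apply: functional_extensionality => m.
exact: sums_to_unique (GE m) (sums_to_gB m).
Qed.
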